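(* Let $f$ be an admissible polynomial. There exists a constant $\delta_f\in\mathbb{R}_+$ depending only on $f$ such that the following holds. Let $n\in\mathbb{Z}_+$, let $\delta\in\mathbb{Z}_+$ with $\delta\mid\Pi_f$, and let $a,k\in\mathbb{Z}_+$ (possibly varying with $n$) be such that for every prime $p\mid k$ one has $(p\delta)\nmid\Pi_f$, and such that $k=o\left(n^{1/(2+2\deg(f))}/\sqrt{\log n}\right)$. Then $$p_f(a,\delta k;n)=\frac{p_f(a,\delta;n)}{k}\left(1+O\left(n\exp\left(-\delta_f k^{-2}n^{\frac{1}{1+\deg(f)}}\right)\right)\right),$$ as $n\to\infty$ with $n\equiv af(0)\pmod{\delta}$, where the implied constant in $O$ depends only on $f$.
   Context: Admissible polynomial: $f(x)\in\mathbb{Q}[x]$ is a nonconstant polynomial that is integer-valued (i.e. $f(\mathbb{Z})\subseteq\mathbb{Z}$), satisfies $f(\ell)>0$ for all integers $\ell\ge 1$, and is such that for every prime $p$ there exists an integer $\ell$ with $p\nmid f(\ell)$. $\Pi_f$ is the product over primes $p$ of $p^{s}$, where $p^s$ is the largest power of $p$ dividing $f(\ell)-f(0)$ for all $\ell\in\mathbb{Z}$; equivalently $\Pi_f=\gcd\{f(\ell)-f(0):\ell\in\mathbb{Z}\}$. $p_f(m,n)$ is the number of partitions of $n$ with exactly $m$ parts whose parts are taken from the sequence $\{f(\ell)\}_{\ell=1}^\infty$ (if a value occurs several times in the sequence, its occurrences count as distinct kinds of part), so that $$\sum_{m,n\ge 0}p_f(m,n)\zeta^mq^n=\prod_{n\ge1}\frac{1}{1-\zeta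 q^{f(n)}}$$ for complex $q$ with $|q|<1$ and complex $\zeta$ with $|\zeta|<1/|q|$. For $k\in\mathbb{Z}_+$ and $a\in\mathbb{Z}$, $p_f(a,k;n):=\sum_{m\ge 0,\ m\equiv a\ (\mathrm{mod}\ k)}p_f(m,n)$, the number of such partitions of $n$ whose number of parts is congruent to $a$ modulo $k$. *)

(* Defs.v *)
From mathcomp Require Export all_boot all_order all_algebra.
From mathcomp Require Export finmap multiset.
From mathcomp Require Export all_classical all_reals all_analysis.
Export numFieldNormedType.Exports.

Set Implicit Arguments.
Unset Strict Implicit.
Unset Printing Implicit Defensive.

Import Order.TTheory GRing.Theory Num.Theory.
Local Open Scope classical_set_scope.
Local Open Scope ring_scope.

(* The floor only serves to land in [int]: it is exact when f is
   integer-valued. *)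
Definition intval (f : {poly rat}) (l : int) : int := Num.floor f.[l%:~R].

Definition admissible (f : {poly rat}) : Prop :=
  [/\ (1 < size f)%N,
      forall l : int, f.[l%:~R] \is a Num.int,
      forall l : int, 1 <= l -> 0 < f.[l%:~R]
    & forall p : nat, prime p -> exists l : int, ~~ (p %| intval f l)%Z].

Definition pdeg (f : {poly rat}) : nat := (size f).-1.

(* The gcd of the infinite family f(l) - f(0), l ranging over the integers,
   singled out among the naturals by its universal property; [Pi_fP] below
   shows that the default value 0 of [xget] plays no role. *)
Definition is_gcd_diff (f : {poly rat}) (d : nat) : Prop :=
  forall e : nat,
    (e %| d)%N <-> (forall l : int, (e %| intval f l - intval f 0)%Z).

Definition Pi_f (f : {poly rat}) : nat := xget 0%N [set d | is_gcd_diff f d].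

Lemma Pi_fP (f : {poly rat}) : is_gcd_diff f (Pi_f f).
Proof.
rewrite /Pi_f; case: xgetP => [d _ //|/= none]; exfalso.
pose v l := intval f l - intval f 0.
pose cd (s : seq int) := \big[gcdn/0%N]_(l <- s) `|v l|%N.
have cdP s e : (e %| cd s)%N = all (fun l => (e %| v l)%Z) s.
  elim: s => [|l s IH]; first by rewrite /cd big_nil dvdn0.
  by rewrite /cd big_cons dvdn_gcd IH.
have [v0|/existsNP[l0 /eqP vl0]] := pselect (forall l, v l = 0).
  by apply: (none 0%N) => e; split=> // _ l; rewrite -/(v l) v0 dvdz0.
have exm : exists m, (0 < m)%N && `[< exists s, cd s = m >].
  exists (cd [:: l0]); rewrite /cd big_seq1 absz_gt0 vl0 /=.
  by apply/asboolP; exists [:: l0]; rewrite big_seq1.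
case: (ex_minnP exm) => m /andP[m0 /asboolP[s sm]] mmin.
apply: (none m) => e; split=> [em l|H]; last first.
  by rewrite -sm cdP; apply/allP => l _; exact: H.
apply: (@dvdz_trans m); first by [].
have dvd : (cd (l :: s) %| m)%N.
  by rewrite -sm /cd big_cons dvdn_gcdr.
have /eqP <- : cd (l :: s) == m.
  rewrite eqn_leq dvdn_leq //= mmin // (dvdn_gt0 m0 dvd) /=.
  by apply/asboolP; exists (l :: s).
by rewrite /cd big_cons; exact: dvdn_gcdl.
Qed.

(* A partition into parts f(l), l >= 1, is recorded by the multiset of its
   indices l, so that repeated values of f count as distinct kinds of part. *)
Definition partitions (f : {poly rat}) (m n : nat) : set {mset nat}%mset :=
  [set A : {mset nat}%mset | [/\ 0%N \notin A, size (A : seq nat) = m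
                          & \sum_(l <- A) f.[l%:R] = n%:R]].

(* For admissible f these sets are finite ([fset_set] would return the empty
   set on an infinite one). *)
Definition npart (f : {poly rat}) (m n : nat) : nat :=
  #|` fset_set (partitions f m n)|%fset.

(* Sum over all m >= 0 congruent to a modulo k; it has finite support, since
   parts are at least 1 when f is admissible. *)
Definition npart_mod (f : {poly rat}) (a : int) (k n : nat) : nat :=
  \big[addn/0%N]_(m \in [set m : nat | (m = a %[mod k])%Z]) npart f m n.

(* Main.v *)
(* Record a partition by its multiplicities u, and let P = Pi_f.  By Bezout and the
   vanishing of the N-th differences of f (N = size f), there are many disjoint
   "gadgets": two local configurations of multiplicities of equal weight whose
   numbers of parts differ by P.  Exchanging the two configurations of a gadget is a
   weight-preserving involution that moves (number of parts - a) / delta by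
   +-P/delta, a unit modulo k.  Averaging over all active gadgets of a partition is a
   walk on Z/k, each step of which contracts the L^2-norm of mean-zero functions by
   1 - O(1/k^2); so the residues equidistribute up to exp(- c r / k^2), with r the
   number of active gadgets.

   With L = n^(1/(1 + deg f)), about L gadgets fit at parts of size about n / L.  Under
   the Gibbs measure exp(- t * weight), t about L / n, they are independently active
   with a fixed probability, so all but a proportion exp(- c L) of the measure has
   at least c' L active gadgets.  The partitions of n carry at least
   exp(- eps L) / n of the measure: t is tuned to make the mean weight slightly below
   n, the weight concentrates there, and the number of partitions of n is monotone in
   n up to a bounded shift. *)

Require Import Defs.
From mathcomp Require Import ring lra zify.
Import Order.TTheory GRing.Theory Num.Theory.
Set Implicit Arguments.
Unset Strict Implicit.
Unset Printing Implicit Defensive.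
Local Open Scope ring_scope.

(** * Arithmetic of integer-valued polynomials *)

(** Bezout gives a relation between $f(0),\dots,f(N-1)$ of weight $0$ whose coefficients sum to $P$.
    On its own it is a single gadget, and index $0$ is not an admissible part. The $N$-th difference
    with step $y$ carries it to the indices $(j+1)y+b$ with the same coefficients for every $y$.
    Varying $y$ gives many disjoint gadgets with bounded multiplicities, placed where $t f$ is of
    order 1, hence active with probability bounded below.

    No asymptotic formula for the number of partitions is required. The swaps act on the partitions
    of exactly $n$, and the Gibbs measure only serves to show that those with few active gadgets are
    rare. For this a lower bound on the number of partitions that loses $\exp(-\epsilon L)/n$ is
    enough, because $\epsilon$ can be fixed after the rate at which few active gadgets become
    unlikely.

    The factor $n$ in the error has two origins: the loss $1/n$ of that lower bound, and the factor
    $k\le n$ that appears when the error is measured relative to $p_f(a,\delta;n)/k$. *)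

Definition dcoef (N j : nat) : int := (-1) ^+ j *+ 'C(N, j).

Lemma dcoef0 N : dcoef N 0 = 1.
Proof. by rewrite /dcoef bin0. Qed.

Lemma dcoefS N j : dcoef N.+1 j.+1 = dcoef N j.+1 - dcoef N j.
Proof. by rewrite /dcoef binS mulrnDr exprS mulN1r [X in _ + X]mulNrn. Qed.

Lemma dcoefnn N : dcoef N N = (-1) ^+ N.
Proof. by rewrite /dcoef binn. Qed.

Lemma dcoef_small N j : (N < j)%N -> dcoef N j = 0.
Proof. by move=> Nj; rewrite /dcoef bin_small. Qed.

Lemma sum_dcoefS (R : comNzRingType) (N : nat) (g : nat -> R) :
  \sum_(j < N.+2) (dcoef N.+1 j)%:~R * g j =
  \sum_(j < N.+1) (dcoef N j)%:~R * (g j - g j.+1).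
Proof.
rewrite big_ord_recl /= !dcoef0.
under eq_bigr => j _ do rewrite /bump /= add1n dcoefS intrB mulrBl.
rewrite sumrB addrA.
under [RHS]eq_bigr => j _ do rewrite mulrBr.
rewrite sumrB; congr (_ - _).
rewrite big_ord_recr /= dcoef_small // mul0r addr0.
rewrite [RHS]big_ord_recl /= dcoef0; congr (_ + _).
Qed.

(** Translation preserves the leading coefficient, so it cancels in the difference. *)
Lemma size_comp_XaddC_sub (F : fieldType) (N : nat) (p : {poly F}) (y : F) :
  (size p <= N.+1)%N -> (size (p - (p \Po ('X + y%:P)))%R <= N)%N.
Proof.
move=> sp; apply/leq_sizeP => j; rewrite leq_eqVlt coefB => /orP[/eqP <-|Nj].
  have [->|p0] := eqVneq p 0; first by rewrite comp_poly0 subrr.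
  have sc : size (p \Po ('X + y%:P)) = size p by rewrite size_comp_poly2 ?size_XaddC.
  case: (ltnP (size p) N.+1) => [spN|Nsp].
    by rewrite !nth_default ?subrr // ?sc -ltnS.
  have sE : size p = N.+1 by apply/eqP; rewrite eqn_leq sp Nsp.
  have := @lead_coef_comp _ p ('X + y%:P); rewrite size_XaddC => /(_ isT).
  rewrite [lead_coef ('X + _)]lead_coefDl ?size_polyX ?size_polyC; last by case: (y == 0).
  by rewrite lead_coefX expr1n mulr1 !lead_coefE sc sE /= => ->; rewrite subrr.
have pj : (size p <= j)%N := leq_trans sp Nj.
by rewrite !nth_default ?subrr // size_comp_poly2 ?size_XaddC.
Qed.

Lemma finite_difference_eq0 (N : nat) (p : {poly rat}) (b y : rat) :
  (size p <= N)%N -> \sum_(j < N.+1) (dcoef N j)%:~R * p.[b + j%:R * y] = 0.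
Proof.
elim: N p b => [|N IH] p b sp.
  by move: sp; rewrite leqn0 size_poly_eq0 => /eqP->; rewrite big_ord1 horner0 mulr0.
rewrite (sum_dcoefS N (fun j => p.[b + j%:R * y])) -[RHS](IH _ b (size_comp_XaddC_sub y sp)).
apply: eq_bigr => j _; congr (_ * _).
by rewrite hornerD hornerN horner_comp hornerD hornerX hornerC -natr1 mulrDl mul1r addrA.
Qed.

Lemma sum_dcoef N : \sum_(j < N.+2) dcoef N.+1 j = 0.
Proof.
have := sum_dcoefS N (fun _ => 1 : int).
under eq_bigr => j _ do rewrite mulr1 intz.
by move=> ->; rewrite big1 // => j _; rewrite subrr mulr0.
Qed.

Section Admissible.
Variables (f : {poly rat}) (hf : admissible f).

Lemma intvalE l : (intval f l)%:~R = f.[l%:~R] :> rat.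
Proof. by case: hf => _ fz _ _; rewrite /intval floorK. Qed.

Lemma size_admissible : size f = (pdeg f).+1.
Proof. by case: hf => sf _ _ _; rewrite /pdeg prednK //; apply: leq_trans sf. Qed.

Lemma pdeg_gt0 : (0 < pdeg f)%N.
Proof. by case: hf => sf _ _ _; rewrite /pdeg -subn1 subn_gt0. Qed.

Lemma intval_difference (b y : int) :
  \sum_(j < (size f).+1) dcoef (size f) j * intval f (b + j%:Z * y) = 0.
Proof.
apply: (@intr_inj rat); rewrite rmorph_sum /=.
rewrite -[RHS](finite_difference_eq0 b%:~R y%:~R (leqnn (size f))).
by apply: eq_bigr => j _; rewrite intrM intvalE intrD intrM.
Qed.

(** Since [y] is free, this trades the value at [b] for values at indices as remote as desired. The
    gadgets rest on it. *)
Lemma intval_difference_top (b : int) (y : int) :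
  intval f b = - \sum_(j < size f) dcoef (size f) j.+1 * intval f (b + j.+1%:Z * y).
Proof.
have := intval_difference b y; rewrite big_ord_recl dcoef0 mul1r mul0r addr0 => /eqP.
by rewrite addr_eq0 => /eqP.
Qed.

Lemma intval_gt0 (l : nat) : (0 < l)%N -> 0 < intval f l.
Proof.
case: hf => _ _ fp _ l0; rewrite -(ltr_int rat) intvalE; apply: fp.
by rewrite lez_nat.
Qed.

End Admissible.

(** The last coefficient of the difference operator is a sign, so divisibility of [N] consecutive
    values passes to the next one. *)
Lemma dvdz_difference_up (N : nat) (e : int) (w : int -> int) :
  (forall b, \sum_(j < N.+1) dcoef N j * w (b + j%:Z) = 0) ->
  forall b : int, (forall j : nat, (j < N)%N -> (e %| w (b + j%:Z))%Z) ->
  forall j : nat, (e %| w (b + j%:Z))%Z.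
Proof.
move=> w0 b wb j; have [n] := ubnP j; elim: n j => // n IH j.
rewrite ltnS => jn; case: (ltnP j N) => [/wb //|Nj].
have := w0 (b + (j - N)%:Z); rewrite big_ord_recr /= dcoefnn.
rewrite -addrA -PoszD subnK // => /eqP; rewrite addrC addr_eq0 => /eqP H.
suff : (e %| (-1) ^+ N * w (b + j%:Z))%Z.
  by rewrite -signr_odd mulr_sign; case: odd; rewrite ?rpredN.
rewrite H rpredN; apply: rpred_sum => i _; rewrite dvdz_mull //.
rewrite -addrA -PoszD; apply: IH.
by apply: leq_trans jn; have := ltn_ord i; lia.
Qed.

(** The first coefficient of the difference operator is 1, so the recurrence can also be run
    downwards. *)
Lemma dvdz_difference (N : nat) (e : int) (w : int -> int) :
  (forall b, \sum_(j < N.+1) dcoef N j * w (b + j%:Z) = 0) ->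
  forall b : int, (forall j : nat, (j < N)%N -> (e %| w (b + j%:Z))%Z) ->
  forall l, (e %| w l)%Z.
Proof.
move=> w0 b wb l.
have up := dvdz_difference_up w0.
suff down (m : nat) : forall j : nat, (e %| w (b - m%:Z + j%:Z))%Z.
  have := down `|(l - b)%R|%N `|(l - b + `|(l - b)%R|%N%:Z)%R|%N.
  by rewrite (_ : b - _ + _ = l) //; lia.
elim: m => [|m IH]; first by rewrite subr0; exact: up.
apply: up => j; case: j => [|j] jN; last first.
  by rewrite (_ : _ - _ + _ = b - m%:Z + j%:Z); [exact: IH | lia].
rewrite addr0; have := w0 (b - m.+1%:Z); rewrite big_ord_recl dcoef0 mul1r addr0.
move=> /eqP; rewrite addr_eq0 => /eqP ->; rewrite rpredN.
apply: rpred_sum => i _; rewrite dvdz_mull //.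
by rewrite (_ : _ - _ + _ = b - m%:Z + i%:Z); [exact: IH | rewrite lift0; lia].
Qed.

Lemma bezout_family (N : nat) (w : nat -> int) :
  exists c : nat -> int, exists g : nat, \sum_(i < N) c i * w i = g%:Z /\
    forall i, (i < N)%N -> (g %| w i)%Z.
Proof.
elim: N => [|N [c [g [cg gw]]]]; first by exists (fun=> 0), 0%N; rewrite big_ord0.
have [u [v uv]] := Bezoutz g%:Z (w N).
exists (fun i => if (i < N)%N then u * c i else v), (gcdn g `|w N|%N); split.
  rewrite big_ord_recr /= ltnn -[RHS]uv -cg mulr_sumr; congr (_ + _).
  by apply: eq_bigr => i _; rewrite ltn_ord mulrA.
move=> i; rewrite ltnS leq_eqVlt => /orP[/eqP ->|/gw gi].
  by rewrite dvdzE dvdn_gcdr.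
by apply: dvdz_trans gi; rewrite dvdzE dvdn_gcdl.
Qed.

Section AdmissibleArith.
Variables (f : {poly rat}) (hf : admissible f).

Lemma Pi_f_dvd (l : int) : (Pi_f f %| intval f l - intval f 0)%Z.
Proof. by move/Pi_fP: (dvdnn (Pi_f f)). Qed.

Lemma intval_difference1 (b : int) :
  \sum_(j < (size f).+1) dcoef (size f) j * intval f (b + j%:Z) = 0.
Proof.
rewrite -[RHS](intval_difference hf b 1); apply: eq_bigr => j _.
by rewrite mulr1.
Qed.

Lemma dvdz_intval (e b : int) :
  (forall j : nat, (j < size f)%N -> (e %| intval f (b + j%:Z))%Z) ->
  forall l, (e %| intval f l)%Z.
Proof. exact: dvdz_difference intval_difference1 b. Qed.

(** The gcd of [N] consecutive values divides every value of [f], so it is 1 by admissibility.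
    Separating the signs in a Bezout relation gives two elements [a = b + 1] of the semigroup
    generated by these values, and consecutive elements generate everything from some point on. *)
Lemma intval_semigroup : exists C0 : nat, forall h, (C0 <= h)%N ->
  exists e : nat -> nat, (\sum_(i < size f) e i * `|intval f i.+1%:Z|)%N = h.
Proof.
have [c [g [cg gw]]] := bezout_family (size f) (fun i => intval f i.+1%:Z).
have g1 : g = 1%N.
  apply/eqP; case: (ltngtP g 1%N) => // [|g1].
    rewrite ltnS leqn0 => /eqP g0; have := gw 0%N.
    rewrite g0 dvd0z (gt_eqF (intval_gt0 hf _)) //; apply.
    by rewrite size_admissible.
  have gl : forall l, (g %| intval f l)%Z.
    by apply: (@dvdz_intval _ 1) => j /gw; rewrite -PoszD add1n.
  case: hf => _ _ _ /(_ (pdiv g) (pdiv_prime g1))[l].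
  by rewrite (dvdz_trans _ (gl l)) // dvdzE pdiv_dvd.
pose F i := `|intval f i.+1%:Z|%N.
have FE i : intval f i.+1%:Z = (F i)%:Z by rewrite gtz0_abs ?intval_gt0.
pose cp i := if 0 <= c i then `|c i|%N else 0%N.
pose cn i := if 0 <= c i then 0%N else `|c i|%N.
have cE i : c i = (cp i)%:Z - (cn i)%:Z by rewrite /cp /cn; case: (leP 0 (c i)) => ?; lia.
pose a := (\sum_(i < size f) cp i * F i)%N.
pose b := (\sum_(i < size f) cn i * F i)%N.
have ab : a = b.+1.
  apply/eqP; rewrite -eqz_nat -addn1 PoszD -subr_eq0 opprD addrA subr_eq0 -g1 -cg.
  rewrite /a /b !(big_morph Posz PoszD (erefl _)) -sumrB; apply/eqP; apply: eq_bigr => i _.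
  by rewrite FE cE !PoszM mulrBl.
have s0 : (0 < F 0)%N by have := intval_gt0 hf (ltn0Sn 0); rewrite FE.
exists (b * F 0)%N => h hb.
pose q := (h %/ F 0)%N; pose r := (h %% F 0)%N.
have hE : h = (q * F 0 + r)%N by exact: divn_eq.
have rs : (r < F 0)%N by rewrite ltn_pmod.
have qb : (b <= q)%N by rewrite leq_divRL.
(* This is $r a + (F_0 - r) b + (q - b) F_0$, which equals $q F_0 + r$ because $a = b + 1$. The
   bound on [h] is what makes $q - b$ nonnegative. *)
exists (fun i => r * cp i + (F 0 - r) * cn i + (i == 0) * (q - b))%N.
under eq_bigr => i _ do rewrite !mulnDl -!mulnA.
rewrite !big_split /= -!big_distrr /= -/a -/b.
rewrite size_admissible // big_ord_recl /= big1 ?addn0 //.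
have key (q' b' r' s' : nat) : (r' <= s' -> b' <= q' ->
  r' * b'.+1 + (s' - r') * b' + 1 * ((q' - b') * s') = q' * s' + r')%N.
  by move=> /subnKC <- /subnKC <-; rewrite !addKn; lia.
by rewrite [RHS]hE ab; apply: key => //; exact: ltnW.
Qed.

(** Otherwise $f - f(0)$ would vanish at [size f] distinct points, more than its degree. *)
Lemma Pi_f_gt0 : (0 < Pi_f f)%N.
Proof.
rewrite lt0n; apply/eqP => Pi0.
have cst l : intval f l = intval f 0.
  by apply/eqP; rewrite -subr_eq0 -dvd0z; have := Pi_f_dvd l; rewrite Pi0.
case: hf => sf _ _ _.
have : f - (intval f 0)%:~R%:P == 0.
  apply/negPn/negP => /max_poly_roots H.
  pose s := [seq (i%:R : rat) | i <- iota 0 (size f)].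
  have := H s; rewrite size_map size_iota.
  have su : uniq s by rewrite map_inj_uniq ?iota_uniq //; apply: mulrIn; rewrite oner_eq0.
  have -> : all (root (f - (intval f 0)%:~R%:P)) s.
    apply/allP => _ /mapP[i _ ->]; rewrite rootE !hornerE.
    by have := intvalE hf i%:Z; rewrite -pmulrn cst => <-; rewrite subrr.
  rewrite su => /(_ isT isT); rewrite size_polyDl ?ltnn //.
  by rewrite size_polyN (leq_ltn_trans (size_polyC_leq1 _)).
rewrite subr_eq0 => /eqP fE; move: sf; rewrite fE size_polyC.
by case: (_ != _).
Qed.

(** The gcd of $f(i) - f(0)$ over $i < N$ is already [Pi_f f], which gives the Bezout coefficients
    to start from. They are then corrected to kill the weight. *)
Lemma intval_gadget : exists c : nat -> int,
  \sum_(b < size f) c b = (Pi_f f)%:Z /\ \sum_(b < size f) c b * intval f b%:Z = 0.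
Proof.
have [c [g [cg gw]]] := bezout_family (size f) (fun i => intval f i%:Z - intval f 0).
have gall : forall l, (g %| intval f l - intval f 0)%Z.
  apply: (@dvdz_difference (size f) _ (fun l => intval f l - intval f 0) _ 0).
    move=> b; under eq_bigr => j _ do rewrite mulrBr.
    rewrite sumrB intval_difference1 -mulr_suml size_admissible // sum_dcoef.
    by rewrite mul0r subrr.
  by move=> j /gw; rewrite add0r.
have gE : g = Pi_f f.
  apply/eqP; rewrite eqn_dvd; apply/andP; split; first exact/Pi_fP.
  suff : (Pi_f f %| g%:Z)%Z by [].
  by rewrite -cg; apply: rpred_sum => i _; rewrite dvdz_mull // Pi_f_dvd.
pose S := \sum_(b < size f) c b; pose f0 := intval f 0.
have T : \sum_(b < size f) c b * intval f b%:Z = (Pi_f f)%:Z + S * f0.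
  rewrite -gE -cg mulr_suml -big_split /=; apply: eq_bigr => i _.
  by rewrite mulrBr subrK.
(* With total $S$ the Bezout coefficients have weight $P + S f(0)$. Scaling them by $-f(0)$ and
   adding $P + S f(0)$ copies of index 0 cancels the weight and leaves the total $P$. *)
exists (fun b => - f0 * c b + (if b == 0%N then (Pi_f f)%:Z + f0 * S else 0)).
have sE := size_admissible hf.
split.
  rewrite big_split /= -mulr_sumr -/S sE big_ord_recl /= big1 ?addr0 //.
  by rewrite addrCA mulNr addNr addr0.
under eq_bigr => b _ do rewrite mulrDl -mulrA.
rewrite big_split /= -mulr_sumr T sE big_ord_recl /= big1 ?addr0; last first.
  by move=> i _; rewrite mul0r.
by rewrite -/f0; ring.
Qed.

(** A prime dividing both [delta] and $f(0)$ would divide every value of [f], against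
    admissibility. *)
Lemma coprime_intval0 (delta : nat) : (delta %| Pi_f f)%N -> coprimez delta (intval f 0).
Proof.
move=> dPi; rewrite /coprimez /gcdz; apply/eqP; congr Posz; apply/eqP.
apply/negPn/negP => g1.
have g0 : (0 < gcdn `|delta%:Z| `|intval f 0|)%N.
  by rewrite gcdn_gt0 absz_nat (dvdn_gt0 Pi_f_gt0 dPi).
have {}g1 : (1 < gcdn `|delta%:Z| `|intval f 0|)%N by rewrite ltn_neqAle eq_sym g1.
set g := gcdn _ _ in g0 g1.
case: hf => _ _ _ /(_ (pdiv g) (pdiv_prime g1))[l] /negP; apply.
have pg := pdiv_dvd g.
rewrite -(subrK (intval f 0) (intval f l)) rpredD //.
  apply: dvdz_trans (Pi_f_dvd l); rewrite dvdzE /=; apply: dvdn_trans dPi.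
  by apply: dvdn_trans pg _; exact: dvdn_gcdl.
by rewrite dvdzE; apply: dvdn_trans pg _; exact: dvdn_gcdr.
Qed.

Lemma intval_growth : exists c0 C0 : rat, [/\ 0 < c0, 0 < C0 &
  forall l : nat, (0 < l)%N ->
    c0 * l%:R ^+ pdeg f <= (intval f l%:Z)%:~R <= C0 * l%:R ^+ pdeg f].
Proof.
set d := pdeg f.
pose S := \sum_(i < d) `|f`_i|; pose a := `|f`_d|.
have a0 : 0 < a.
  rewrite normr_gt0 /d /pdeg -lead_coefE lead_coef_eq0 -size_poly_eq0.
  by rewrite size_admissible.
have S0 : 0 <= S by apply: sumr_ge0.
have d0 := pdeg_gt0 hf.
have fE (x : rat) : f.[x] = \sum_(i < d) f`_i * x ^+ i + f`_d * x ^+ d.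
  by rewrite horner_coef size_admissible // big_ord_recr.
have Sb (x : rat) : 1 <= x -> `|\sum_(i < d) f`_i * x ^+ i| <= S * x ^+ d.-1.
  move=> x1; apply: le_trans (ler_norm_sum _ _ _) _.
  rewrite /S mulr_suml; apply: ler_sum => i _.
  rewrite normrM ler_wpM2l // normrX ger0_norm ?(le_trans ler01) //.
  by rewrite ler_weXn2l // -ltnS prednK.
(* Beyond [X] the lower terms are at most half of the leading one. Up to [X] the bound $f(l) \ge 1$
   is used, which is why $X^{-d}$ enters the lower constant. *)
pose X := 2 * S / a + 1.
have X1 : 1 <= X by rewrite lerDr; apply: divr_ge0; [apply: mulr_ge0 | apply: ltW].
have X0 : 0 < X := lt_le_trans ltr01 X1.
exists (Num.min (a / 2) (X ^- d)), (S + a); split.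
- by rewrite lt_min divr_gt0 //= invr_gt0 exprn_gt0.
- by rewrite ltr_wpDl.
move=> l l0; have x1 : 1 <= (l%:R : rat) by rewrite ler1n.
have x0 : 0 < (l%:R : rat) by rewrite ltr0n.
have fl1 : 1 <= f.[l%:R].
  have := intval_gt0 hf l0; rewrite gtz0_ge1 -(ler_int rat) intvalE //.
have fl : (intval f l%:Z)%:~R = f.[l%:R] by rewrite intvalE.
rewrite fl; set x := l%:R in x1 x0 fl1 *.
have fn : f.[x] = `|f.[x]| by rewrite ger0_norm // (le_trans ler01).
have xd : x ^+ d = x * x ^+ d.-1 by rewrite -exprS prednK.
have xd0 : 0 <= x ^+ d.-1 by rewrite exprn_ge0 // ltW.
have Sbx := Sb x x1.
apply/andP; split; last first.
  rewrite fn fE mulrDl; apply: le_trans (ler_normD _ _) _.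
  apply: lerD; last by rewrite normrM (ger0_norm (exprn_ge0 d (ltW x0))).
  apply: le_trans Sbx _; rewrite xd mulrA ler_wpM2r // -[leLHS]mulr1.
  by rewrite ler_wpM2l.
have [xX|Xx] := leP x X.
  apply: le_trans fl1.
  apply: (@le_trans _ _ (X ^- d * x ^+ d)).
    by rewrite ler_wpM2r ?exprn_ge0 ?(ltW x0) // ge_min lexx orbT.
  rewrite mulrC ler_pdivrMr ?exprn_gt0 // mul1r.
  by rewrite lerXn2r // nnegrE ltW.
apply: (@le_trans _ _ (a / 2 * x ^+ d)).
  by rewrite ler_wpM2r ?exprn_ge0 ?(ltW x0) // ge_min lexx.
have : a * x ^+ d - S * x ^+ d.-1 <= f.[x].
  rewrite fn fE [X in _ <= `|X|]addrC; apply: le_trans (lerB_normD _ _).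
  rewrite normrM (ger0_norm (exprn_ge0 d (ltW x0))) -/a lerB //.
apply: le_trans; rewrite -subr_ge0 xd.
have -> : a * (x * x ^+ d.-1) - S * x ^+ d.-1 - a / 2 * (x * x ^+ d.-1) =
   (a / 2 * x - S) * x ^+ d.-1 by field.
apply: mulr_ge0 => //; rewrite subr_ge0.
have : 2 * S / a <= x by apply: le_trans (ltW Xx); rewrite lerDl.
rewrite ler_pdivrMr // => H; lra.
Qed.

End AdmissibleArith.

(** * Partitions as multiplicity functions *)

Section Multiplicities.
Variables (K H : nat).
Implicit Type u : {ffun 'I_K -> 'I_H.+1}.

Definition wt (w : nat -> nat) u : nat := (\sum_i u i * w i)%N.
Definition cnt u : nat := (\sum_i u i)%N.
Definition partseq u : seq nat := flatten [seq nseq (u i) i.+1 | i <- enum 'I_K].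

Lemma size_partseq u : size (partseq u) = cnt u.
Proof.
rewrite size_flatten /shape -map_comp sumn_map big_enum /=.
by apply: eq_bigr => i _; rewrite /= size_nseq.
Qed.

Lemma big_partseq (R : nmodType) (G : nat -> R) u :
  \sum_(l <- partseq u) G l = \sum_(i < K) G i.+1 *+ u i.
Proof.
rewrite /partseq big_flatten /= big_map big_enum /=; apply: eq_bigr => i _.
by rewrite big_nseq -Monoid.iteropE.
Qed.

Lemma count_partseq u (i : 'I_K) : count_mem i.+1 (partseq u) = u i.
Proof.
rewrite count_flatten -map_comp sumn_map big_enum /= (bigD1 i) //= big1.
  by rewrite count_nseq /= eqxx mul1n addn0.
move=> j ji; rewrite count_nseq /= eqSS; case: eqP => // ji'.
by case/eqP: ji; apply: val_inj.
Qed.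

Lemma partseqP u l : l \in partseq u -> exists i : 'I_K, l = i.+1.
Proof.
by case/flattenP => s /mapP[i _ ->]; rewrite mem_nseq => /andP[_ /eqP->]; exists i.
Qed.

Lemma seq_mset_partseq_inj : injective (fun u => seq_mset (partseq u)).
Proof.
move=> u v /eq_seq_msetP /permP uv; apply/ffunP => i; apply: val_inj => /=.
by rewrite -count_partseq uv count_partseq.
Qed.

End Multiplicities.

Section Npart.
Variables (f : {poly rat}) (hf : admissible f).

(* Indices are shifted by one: index [i] stands for the part [f(i+1)]. *)
Definition wf (i : nat) : nat := `|intval f i.+1%:Z|%N.

Lemma wfE i : (wf i)%:Z = intval f i.+1%:Z.
Proof. by rewrite /wf gtz0_abs // intval_gt0. Qed.

Lemma wf_horner i : (wf i)%:R = f.[i.+1%:R] :> rat.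
Proof. by rewrite pmulrn wfE intvalE. Qed.

Lemma wf_gt0 i : (0 < wf i)%N.
Proof. by rewrite -ltz_nat wfE intval_gt0. Qed.

Lemma cnt_le_wt K H (u : {ffun 'I_K -> 'I_H.+1}) : (cnt u <= wt wf u)%N.
Proof. by apply: leq_sum => i _; rewrite leq_pmulr // wf_gt0. Qed.

(** All parts are at least 1, so a partition of [n] uses no index from [K] on and no multiplicity
    above [n]: the truncations at [K] and [H] lose nothing. *)
Lemma npart_ffun K H m n : (forall i, (K <= i)%N -> (n < wf i)%N) -> (n <= H)%N ->
  npart f m n = #|[set u : {ffun 'I_K -> 'I_H.+1} | (wt wf u == n) && (cnt u == m)]|.
Proof.
move=> Kn nH; set S := [set u | _].
pose phi (u : {ffun 'I_K -> 'I_H.+1}) := seq_mset (partseq u).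
have imE : partitions f m n = [set phi u | u in [set` S]]%classic.
  apply/seteqP; split=> [A [A0 Am An]|_ [u uS <-]] /=; last first.
    move: uS; rewrite /= inE => /andP[/eqP wn /eqP cm].
    have pu := perm_eq_seq_mset (partseq u).
    split.
    - by rewrite (perm_mem pu); apply/negP => /partseqP[].
    - by rewrite (perm_size pu) size_partseq.
    - rewrite (perm_big _ pu) /= big_partseq -wn natr_sum; apply: eq_bigr => i _.
      by rewrite natrM wf_horner mulr_natl.
  have fl l : l \in (A : seq nat) -> (0 < l)%N.
    by case: l => // l0; move: A0; rewrite l0.
  have wn : (\sum_(l <- A) wf l.-1)%N = n.
    apply/eqP; rewrite -(eqr_nat rat) -An natr_sum; apply/eqP.
    rewrite !big_seq; apply: eq_bigr => l /fl l0.
    by rewrite wf_horner prednK.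
  have Ale l : l \in (A : seq nat) -> (A l * wf l.-1 <= n)%N.
    move=> lA; rewrite -wn sum_mset (big_fsetD1 l) /=; last by rewrite msuppE.
    exact: leq_addr.
  have AK l : l \in (A : seq nat) -> (l.-1 < K)%N.
    move=> lA; rewrite ltnNge; apply/negP => /Kn; rewrite ltnNge => /negP; apply.
    by apply: leq_trans (Ale l lA); rewrite leq_pmull // mset_gt0.
  have AH l : l \in (A : seq nat) -> (A l < H.+1)%N.
    move=> lA; rewrite ltnS; apply: leq_trans nH; apply: leq_trans (Ale l lA).
    by rewrite leq_pmulr // wf_gt0.
  pose u : {ffun 'I_K -> 'I_H.+1} := [ffun i => inord (A (nat_of_ord i).+1)].
  have uE (i : 'I_K) : u i = A i.+1 :> nat.
    rewrite ffunE inordK //; have [iA|/mset_eq0P ->//] := boolP (i.+1 \in A).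
    exact: AH.
  have phiu : phi u = A.
    apply/msetP => l; rewrite mset_seqE.
    have [lA|lA] := boolP (l \in A).
      have li := AK l lA; have := count_partseq u (Ordinal li).
      by rewrite uE /= prednK ?fl.
    have [/partseqP[i li]|/count_memPn ->] := boolP (l \in partseq u).
      by rewrite li count_partseq uE.
    by rewrite (mset_eq0P lA).
  have pA : perm_eq A (partseq u) by rewrite -phiu perm_eq_seq_mset.
  exists u => //=; rewrite inE; apply/andP; split; last first.
    by rewrite -size_partseq -(perm_size pA) Am.
  rewrite -wn (perm_big _ pA) /=.
  have := @big_partseq K H nat (fun l => wf l.-1) u; rewrite /= => ->.
  by apply/eqP; apply: eq_bigr => i _; rewrite -mulr_natr mulnC natn.
rewrite /npart imE fset_set_image; last exact: finite_finset.
rewrite card_imfset /=; last exact: seq_mset_partseq_inj.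
rewrite cardE; apply: perm_size; apply: uniq_perm; rewrite ?enum_uniq ?fset_uniq //.
move=> u; rewrite mem_enum; have := in_fset_set (@finite_finset _ [set` S]) u.
by rewrite mem_setE => <-.
Qed.

Lemma npart_mod_ffun K H a k n : (forall i, (K <= i)%N -> (n < wf i)%N) -> (n <= H)%N ->
  npart_mod f a k n = #|[set u : {ffun 'I_K -> 'I_H.+1} |
    (wt wf u == n) && ((cnt u)%:Z == a %[mod k])%Z]|.
Proof.
move=> Kn nH; rewrite /npart_mod.
pose r := [seq m <- iota 0 n.+1 | ((m%:Z == a %[mod k])%Z)].
rewrite (fsbigE r); last 3 first.
- by rewrite filter_uniq // iota_uniq.
- by move=> m; rewrite /= mem_filter => /andP[/eqP].
- move=> m /= ma; rewrite mem_filter ma eqxx mem_iota /= add0n ltnS -ltnNge => nm.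
  rewrite (npart_ffun _ Kn nH); apply/eqP; rewrite cards_eq0 -finset.subset0.
  apply/fintype.subsetP => u; rewrite inE => /andP[/eqP wu /eqP cu].
  by have := cnt_le_wt u; rewrite wu cu leqNgt nm.
rewrite big_filter_cond.
rewrite -sum1_card.
rewrite (partition_big (fun u : {ffun 'I_K -> 'I_H.+1} => inord (cnt u) : 'I_n.+1)
   (fun m : 'I_n.+1 => (m%:Z == a %[mod k])%Z)) /=; last first.
  move=> u; rewrite inE => /andP[/eqP wu cu]; rewrite inordK //.
  by rewrite ltnS -wu cnt_le_wt.
rewrite -[0%N :: _]/(index_iota 0 n.+1) big_mkord; apply: eq_big => [m|m].
  by apply: andb_idr => /eqP ma; exact: mem_set.
move=> /andP[ma _].
rewrite (npart_ffun _ Kn nH) -sum1_card; apply: eq_bigl => u; rewrite !inE.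
case: eqP => //= wu.
have cn : (cnt u < n.+1)%N by rewrite ltnS -wu cnt_le_wt.
apply/eqP/andP => [->|[_ /eqP <-]]; last by rewrite inordK.
by split=> //; apply/eqP/val_inj; rewrite /= inordK.
Qed.

End Npart.

(** * Equidistribution under random swaps *)

Section Contraction.
Variables (R : realType) (k : nat).
Hypothesis k0 : (0 < k)%N.

(** Functions on $\mathbb{Z}/k$ are kept as periodic functions on the integers, so that steps add up
    without reduction. *)
Definition kperiodic (G : int -> R) := forall x, G (x + k%:Z) = G x.

Lemma kperiodicM G : kperiodic G -> forall x y, G (x + k%:Z * y) = G x.
Proof.
move=> pG; suff H x (m : nat) : G (x + k%:Z * m%:Z) = G x.
  move=> x [m|m]; first exact: H.
  by rewrite -(H (x + k%:Z * Negz m) m.+1) NegzE mulrN subrK.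
elim: m => [|m IH]; first by rewrite mulr0 addr0.
by rewrite -addn1 PoszD mulrDr mulr1 addrA pG.
Qed.

Lemma sum_shift1 G : kperiodic G -> \sum_(i < k) G (i%:Z + 1) = \sum_(i < k) G i%:Z.
Proof.
move=> pG; apply/eqP; rewrite -subr_eq0 -sumrB.
rewrite -(big_mkord xpredT (fun i => G (i%:Z + 1) - G i%:Z)).
rewrite (eq_bigr (fun i : nat => G i.+1%:Z - G i%:Z)); last first.
  by move=> i _; rewrite -PoszD addn1.
by rewrite (telescope_sumr (fun i : nat => G i%:Z)) // -[k%:Z]add0r pG subrr.
Qed.

Lemma sum_shift G e : `|e| <= 1 -> kperiodic G ->
  \sum_(i < k) G (i%:Z + e) = \sum_(i < k) G i%:Z.
Proof.
move=> e1 pG; have [->|[->|->]] : e = 0 \/ e = 1 \/ e = -1 by lia.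
- by apply: eq_bigr => i _; rewrite addr0.
- exact: sum_shift1.
rewrite -(@sum_shift1 (fun x => G (x - 1))); last by move=> x; rewrite addrAC pG.
by apply: eq_bigr => i _; rewrite addrK.
Qed.

Lemma sum_sqr_le (a : nat -> R) :
  (\sum_(i < k) a i) ^+ 2 <= k%:R * \sum_(i < k) a i ^+ 2.
Proof.
pose m := (\sum_(i < k) a i) / k%:R.
have kn0 : (k%:R : R) != 0 by rewrite pnatr_eq0 -lt0n.
have : 0 <= \sum_(i < k) (a i - m) ^+ 2 by apply: sumr_ge0 => i _; exact: sqr_ge0.
have -> : \sum_(i < k) (a i - m) ^+ 2 = \sum_(i < k) a i ^+ 2 - (\sum_(i < k) a i) ^+ 2 / k%:R.
  under eq_bigr => i _ do rewrite sqrrB.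
  rewrite big_split sumrB /= sumr_const card_ord sumrMnl -mulr_suml /m -mulr_natl.
  by field.
rewrite subr_ge0 ler_pdivrMr ?ltr0n // mulrC //.
Qed.

(** Two values of [v] differ by at most its variation [D] around the cycle. As the mean is 0, each
    value is then at most [D] in absolute value, and Cauchy-Schwarz bounds $D^2$ by $k$ times the
    energy. *)
Lemma poincare v : kperiodic v -> \sum_(i < k) v i%:Z = 0 ->
  \sum_(i < k) v i%:Z ^+ 2 <= k%:R ^+ 2 * \sum_(i < k) (v (i%:Z + 1) - v i%:Z) ^+ 2.
Proof.
move=> pv v0.
pose D := \sum_(l < k) `|v (l%:Z + 1) - v l%:Z|.
have vD (i j : nat) : (i <= j)%N -> (j <= k)%N -> `|v j%:Z - v i%:Z| <= D.
  move=> ij jk; rewrite -(telescope_sumr (fun l => v l%:Z) ij).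
  apply: le_trans (ler_norm_sum _ _ _) _.
  rewrite /D -(big_mkord xpredT (fun l => `|v (l%:Z + 1) - v l%:Z|)).
  rewrite (big_cat_nat (leq0n i) (leq_trans ij jk)) /= (big_cat_nat ij jk) /=.
  rewrite addrCA ler_wpDr //; first by apply: addr_ge0; apply: sumr_ge0.
  by apply: ler_sum => l _; rewrite -PoszD addn1.
have {}vD (i j : 'I_k) : `|v i%:Z - v j%:Z| <= D.
  case: (leqP i j) => ij; first by rewrite distrC vD // ltnW.
  by rewrite vD // ltnW.
have vi (i : 'I_k) : `|v i%:Z| <= D.
  have kp : 0 < (k%:R : R) by rewrite ltr0n.
  rewrite -(ler_pM2l kp) -{1}(ger0_norm (ltW kp)) -normrM mulr_natl.
  have -> : v i%:Z *+ k = \sum_(j < k) (v i%:Z - v j%:Z).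
    by rewrite sumrB v0 subr0 sumr_const card_ord.
  apply: le_trans (ler_norm_sum _ _ _) _.
  apply: (@le_trans _ _ (\sum_(j < k) D)); first by apply: ler_sum => j _; exact: vD.
  by rewrite sumr_const card_ord mulr_natl.
have DD := sum_sqr_le (fun l => `|v (l%:Z + 1) - v l%:Z|).
rewrite -/D in DD.
apply: (@le_trans _ _ (\sum_(i < k) D ^+ 2)).
  apply: ler_sum => i _; rewrite -real_normK ?num_real //.
  by rewrite lerXn2r ?nnegrE ?(le_trans _ (vi i)).
rewrite sumr_const card_ord -[D ^+ 2 *+ k]mulr_natl [k%:R ^+ 2]expr2 -mulrA ler_wpM2l ?ler0n //.
apply: le_trans DD _; rewrite ler_wpM2l ?ler0n //.
by apply: ler_sum => i _; rewrite real_normK ?num_real.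
Qed.

Definition rho : R := 1 - (4 * k%:R ^+ 2)^-1.

(** The identity $((x+y)/2)^2 = (x^2+y^2)/2 - (x-y)^2/4$ shows that averaging loses a quarter of the
    energy, which [poincare] bounds below by the norm. *)
Lemma contraction G e : `|e| <= 1 -> e != 0 -> kperiodic G -> \sum_(i < k) G i%:Z = 0 ->
  \sum_(i < k) ((G i%:Z + G (i%:Z + e)) / 2) ^+ 2 <= rho * \sum_(i < k) G i%:Z ^+ 2.
Proof.
move=> e1 en0 pG G0.
pose E := \sum_(i < k) (G (i%:Z + 1) - G i%:Z) ^+ 2.
have EE : \sum_(i < k) (G i%:Z - G (i%:Z + e)) ^+ 2 = E.
  have [->|->] : e = 1 \/ e = -1 by lia.
    by apply: eq_bigr => i _; rewrite -sqrrN opprB.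
  rewrite -(@sum_shift1 (fun x => (G x - G (x - 1)) ^+ 2)).
    by apply: eq_bigr => i _; rewrite addrK.
  by move=> x; rewrite addrAC !pG.
have S2 : \sum_(i < k) G (i%:Z + e) ^+ 2 = \sum_(i < k) G i%:Z ^+ 2.
  by apply: (@sum_shift (fun x => G x ^+ 2)) => // x; rewrite pG.
have -> : \sum_(i < k) ((G i%:Z + G (i%:Z + e)) / 2) ^+ 2 =
    \sum_(i < k) G i%:Z ^+ 2 - E / 4.
  rewrite -EE.
  have -> : \sum_(i < k) G i%:Z ^+ 2 = (\sum_(i < k) G i%:Z ^+ 2 + \sum_(i < k) G (i%:Z + e) ^+ 2) / 2.
    by rewrite S2; field.
  rewrite -big_split /= !mulr_suml -sumrB; apply: eq_bigr => i _; by field.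
rewrite /rho mulrBl mul1r lerB //.
have := poincare pG G0; rewrite -/E => P.
have kp : 0 < (k%:R : R) ^+ 2 by rewrite exprn_gt0 // ltr0n.
rewrite invfM mulrAC -mulrA [E / 4]mulrC ler_pM2l ?invr_gt0 ?ltr0n //.
by rewrite mulrC ler_pdivrMl.
Qed.

Lemma rho_ge0 : 0 <= rho.
Proof.
rewrite /rho subr_ge0 invf_le1; last by rewrite mulr_gt0 ?exprn_gt0 ?ltr0n.
have : 1 <= (k%:R : R) by rewrite ler1n.
by rewrite expr2; nra.
Qed.

(* The expectation of [G] after a walk from [x] that takes each step of [s]
   independently with probability 1/2. *)
Fixpoint walk (s : seq int) (G : int -> R) (x : int) : R :=
  if s is e :: s' then (walk s' G x + walk s' G (x + e)) / 2 else G x.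

Lemma walk_periodic s G : kperiodic G -> kperiodic (walk s G).
Proof. by move=> pG; elim: s => //= e s IH x; rewrite IH addrAC IH. Qed.

Lemma walk_sum s G : kperiodic G -> all (fun e => `|e| <= 1) s ->
  \sum_(i < k) walk s G i%:Z = \sum_(i < k) G i%:Z.
Proof.
move=> pG; elim: s => //= e s IH /andP[e1 s1].
rewrite -mulr_suml big_split /= sum_shift //; last exact: walk_periodic.
by rewrite IH //; field.
Qed.

Lemma walk_contraction s G : kperiodic G -> all (fun e => `|e| <= 1) s ->
  \sum_(i < k) G i%:Z = 0 ->
  \sum_(i < k) walk s G i%:Z ^+ 2 <=
    rho ^+ count (fun e => e != 0) s * \sum_(i < k) G i%:Z ^+ 2.
Proof.
move=> pG + G0; elim: s => [_|e s IH /= /andP[e1 s1]]; first by rewrite mul1r.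
have half (z : R) : (z + z) / 2 = z by field.
have [->|e0] /= := eqVneq e 0.
  by under eq_bigr => i _ do rewrite addr0 half; exact: IH.
rewrite exprS -mulrA; apply: le_trans (ler_wpM2l rho_ge0 (IH s1)).
by apply: contraction => //; [exact: walk_periodic | rewrite walk_sum].
Qed.

Lemma walk_cst s G m x : walk s (fun y => G y - m) x = walk s G x - m.
Proof. by elim: s x => //= e s IH x; rewrite !IH; field. Qed.

Definition dvdind (x : int) : R := (k %| x)%Z%:R.

Lemma dvdind_periodic : kperiodic dvdind.
Proof. by move=> x; rewrite /dvdind rpredDr ?dvdzz. Qed.

Lemma dvdind_sum : \sum_(i < k) dvdind i%:Z = 1.
Proof.
rewrite (bigD1 (Ordinal k0)) //= /dvdind dvdz0 big1 ?addr0 // => i i0.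
by rewrite dvdzE /= gtnNdvd // lt0n; apply: contraNneq i0 => i0; apply/eqP/val_inj.
Qed.

(** The indicator minus its mean has squared norm at most 1, and a single value is bounded by the
    norm. The square root turns the 4 of [rho] into 8. *)
Lemma walk_dvdind s x : all (fun e => `|e| <= 1) s ->
  `|walk s dvdind x - k%:R^-1| <= expR (- ((count (fun e => e != 0) s)%:R / (8 * k%:R ^+ 2))).
Proof.
move=> s1.
have kp : 0 < (k%:R : R) by rewrite ltr0n.
pose G x := dvdind x - k%:R^-1.
have pG : kperiodic G by move=> y; rewrite /G dvdind_periodic.
have G0 : \sum_(i < k) G i%:Z = 0.
  by rewrite sumrB dvdind_sum sumr_const card_ord -[_ *+ k]mulr_natl mulfV ?subrr // gt_eqF.
have G2 : \sum_(i < k) G i%:Z ^+ 2 <= 1.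
  have GE i : G i ^+ 2 = dvdind i - 2 * k%:R^-1 * dvdind i + k%:R^-1 ^+ 2.
    by rewrite /G /dvdind; case: (_ %| _)%Z => /=; ring.
  under eq_bigr => i _ do rewrite GE.
  rewrite big_split sumrB -mulr_sumr /= dvdind_sum sumr_const card_ord mulr1.
  rewrite -[_ ^+ 2 *+ k]mulr_natl expr2 mulrA mulfV ?gt_eqF // mul1r.
  have : 0 < (k%:R : R)^-1 by rewrite invr_gt0.
  lra.
have := walk_contraction pG s1 G0.
set c := count _ _ => W.
rewrite -walk_cst -/G.
have pW := walk_periodic s pG.
have [i xi] : exists i : 'I_k, walk s G x = walk s G i%:Z.
  have xk : (`|(x %% k)%Z| < k)%N by lia.
  exists (Ordinal xk); have x0 : 0 <= (x %% k)%Z by lia.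
  rewrite /= gez0_abs //.
  by rewrite [in LHS](divz_eq x k) addrC [_ * k%:Z]mulrC (kperiodicM pW).
rewrite xi.
have {}W : walk s G i%:Z ^+ 2 <= rho ^+ c.
  apply: le_trans (le_trans W _); last by rewrite ler_piMr // exprn_ge0 // rho_ge0.
  by rewrite (bigD1 i) //= lerDl; apply: sumr_ge0 => j _; exact: sqr_ge0.
have rE : rho ^+ c <= expR (- (c%:R / (8 * k%:R ^+ 2))) ^+ 2.
  rewrite -expRM_natl.
  have -> : 2 * - (c%:R / (8 * k%:R ^+ 2)) = c%:R * - (4 * k%:R ^+ 2)^-1 :> R.
    by field; exact: lt0r_neq0.
  rewrite expRM_natl lerXn2r ?nnegrE ?rho_ge0 ?expR_ge0 //.
  exact: expR_ge1Dx.
rewrite -(@ler_pXn2r _ 2%N) ?nnegrE ?expR_ge0 // real_normK ?num_real //.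
exact: le_trans rE.
Qed.

End Contraction.

Section Equidistribution.
Variables (R : realType) (k r : nat) (T : finType) (A : {set T}).
Variables (sigma : 'I_r -> T -> T) (eps : 'I_r -> T -> int) (b : T -> int).
Hypothesis k0 : (0 < k)%N.
Hypothesis sigmaK : forall i, involutive (sigma i).
Hypothesis sigmaA : forall i x, (sigma i x \in A) = (x \in A).
Hypothesis eps1 : forall i x, `|eps i x| <= 1.
Hypothesis eps_sigma : forall i j x, j != i -> eps j (sigma i x) = eps j x.
Hypothesis b_sigma : forall i x, (b (sigma i x) = b x + eps i x %[mod k])%Z.

(** Each [sigma i] permutes [A], so the sum may be averaged over it. It leaves the other [eps j]
    unchanged, so the remaining steps of the walk stay the same while its starting point moves by
    [eps i x]. *)
Lemma sum_walk (G : int -> R) (s : seq 'I_r) : kperiodic k G -> uniq s ->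
  \sum_(x in A) G (b x) = \sum_(x in A) walk [seq eps i x | i <- s] G (b x).
Proof.
move=> pG; elim: s => [|i s IH] //= /andP[si /IH ->].
set h := fun x => walk [seq eps j x | j <- s] G (b x).
under [RHS]eq_bigr => x _.
  have -> : walk [seq eps j x | j <- s] G (b x + eps i x) = h (sigma i x).
    rewrite /h; have -> : [seq eps j (sigma i x) | j <- s] = [seq eps j x | j <- s].
      by apply/eq_in_map => j js; apply: eps_sigma; apply: contraNneq si => <-.
    have pW := @walk_periodic R k [seq eps j x | j <- s] G pG.
    have := b_sigma i x => /eqP; rewrite eqz_mod_dvd => /dvdzP[q /eqP].
    by rewrite subr_eq addrC [q * _]mulrC => /eqP ->; rewrite (kperiodicM pW).
  over.
rewrite -mulr_suml big_split /= -/h.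
have -> : \sum_(x in A) h (sigma i x) = \sum_(x in A) h x.
  rewrite [RHS](reindex_inj (inv_inj (sigmaK i))); apply: eq_bigl => x.
  by rewrite sigmaA.
by field.
Qed.

Lemma equidistribution :
  `| #|[set x in A | (k %| b x)%Z]|%:R - #|A|%:R / k%:R | <=
  \sum_(x in A) expR (- (#|[set i | eps i x != 0]|%:R / (8 * k%:R ^+ 2))) :> R.
Proof.
have -> : #|[set x in A | (k %| b x)%Z]|%:R = \sum_(x in A) dvdind R k (b x).
  rewrite -sum1_card natr_sum big_mkcond [RHS]big_mkcond; apply: eq_bigr => x _.
  by rewrite inE; case: (x \in A); rewrite //= /dvdind; case: (_ %| _)%Z.
have -> : #|A|%:R / k%:R = \sum_(x in A) k%:R^-1 :> R.
  by rewrite sumr_const mulr_natl.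
rewrite (sum_walk (@dvdind_periodic R k) (enum_uniq 'I_r)) -sumrB.
apply: le_trans (ler_norm_sum _ _ _) _; apply: ler_sum => x _.
apply: le_trans (@walk_dvdind R k k0 _ _ _) _ => //.
  by apply/allP => _ /mapP[i _ ->].
rewrite ler_expR lerN2 ler_wpM2r ?invr_ge0 ?mulr_ge0 ?exprn_ge0 ?ler0n //.
rewrite ler_nat count_map cardE -size_filter enumT.
by apply: eq_leq; congr size; apply: eq_filter => i; rewrite !inE.
Qed.

End Equidistribution.

(** * Swaps of local configurations, and their independence under product weights *)

Section Gadgets.
Variables (K H r : nat) (J : finType) (pos : 'I_r -> J -> 'I_K).
Hypothesis pos_inj : forall i c i' c', pos i c = pos i' c' -> i = i' /\ c = c'.
Implicit Types (u : {ffun 'I_K -> 'I_H.+1}) (g : J -> 'I_H.+1).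

Definition inst g i u := [forall c, u (pos i c) == g c].

Definition put g i u : {ffun 'I_K -> 'I_H.+1} :=
  [ffun x => if [pick c | pos i c == x] is Some c then g c else u x].

Lemma put_pos g i u c : put g i u (pos i c) = g c.
Proof.
rewrite ffunE; case: pickP => [c' /eqP /pos_inj [_ ->] //|/(_ c)].
by rewrite eqxx.
Qed.

Lemma put_out g i u x : (forall c, pos i c != x) -> put g i u x = u x.
Proof. by move=> nx; rewrite ffunE; case: pickP => // c; rewrite (negbTE (nx c)). Qed.

Lemma put_other g i j u c : j != i -> put g i u (pos j c) = u (pos j c).
Proof.
by move=> ji; apply: put_out => c'; apply: contraNneq ji => /pos_inj[->].
Qed.

Lemma inst_put g i u : inst g i (put g i u).
Proof. by apply/forallP => c; rewrite put_pos. Qed.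

Lemma inst_put_other g g' i j u : j != i -> inst g' j (put g i u) = inst g' j u.
Proof. by move=> ji; apply: eq_forallb => c; rewrite put_other. Qed.

Lemma put_put g g' i u : inst g i u -> put g i (put g' i u) = u.
Proof.
move=> /forallP gu; apply/ffunP => x.
have [c /eqP <-|nx] := pickP (fun c => pos i c == x).
  by rewrite put_pos (eqP (gu c)).
by rewrite !put_out // => c; rewrite nx.
Qed.

(** Both sides are sums so that no truncated subtraction occurs. [G] is later the weight function,
    or the constant 1 to count parts. *)
Lemma sum_put (G : 'I_K -> nat) g g' i u : inst g i u ->
  (\sum_x put g' i u x * G x + \sum_c g c * G (pos i c) =
   \sum_x u x * G x + \sum_c g' c * G (pos i c))%N.
Proof.
move=> /forallP gu.
have split (v : 'I_K -> nat) : (\sum_x v x * G x =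
   \sum_c v (pos i c) * G (pos i c) + \sum_(x | x \notin [set pos i c | c : J]) v x * G x)%N.
  rewrite (bigID (fun x => x \in [set pos i c | c : J])) /=; congr (_ + _)%N.
  by rewrite big_imset //= => c c' _ _ /pos_inj[].
rewrite (split (fun x => put g' i u x)) (split (fun x => u x)) /=.
under eq_bigr => c _ do rewrite put_pos.
under [in X in _ = X]eq_bigr => c _ do rewrite (eqP (gu c)).
have -> : (\sum_(x | x \notin [set pos i c | c : J]) put g' i u x * G x =
  \sum_(x | x \notin [set pos i c | c : J]) u x * G x)%N.
  apply: eq_bigr => x nx; rewrite put_out // => c; apply: contraNneq nx => <-.
  exact: imset_f.
by rewrite addnAC [RHS]addnAC [X in (X + _ = _)%N]addnC.
Qed.

Variables (al be : J -> 'I_H.+1) (w : nat -> nat) (P : nat).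
Hypothesis wt_albe : forall i, (\sum_c al c * w (pos i c) = \sum_c be c * w (pos i c))%N.
Hypothesis cnt_albe : (\sum_c al c = \sum_c be c + P)%N.
Hypothesis P0 : (0 < P)%N.

Definition swap i u :=
  if inst al i u then put be i u else if inst be i u then put al i u else u.

Definition drift i u : int := if inst al i u then -1 else if inst be i u then 1 else 0.

(** The two states have different numbers of parts, hence exclude each other. This makes [swap] an
    involution. *)
Lemma not_inst_al_be i u : inst be i u -> inst al i u = false.
Proof.
move=> /forallP ub; apply/negP => /forallP ua.
suff : (\sum_c al c = \sum_c be c)%N by move: cnt_albe P0; lia.
by apply: eq_bigr => c _; rewrite -(eqP (ua c)) (eqP (ub c)).
Qed.

Lemma swapK i : involutive (swap i).
Proof.
move=> u; rewrite {2}/swap; case: ifP => ia.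
  by rewrite /swap not_inst_al_be ?inst_put // put_put.
case: ifP => ib; first by rewrite /swap inst_put put_put.
by rewrite /swap ia ib.
Qed.

Lemma wt_swap i u : wt w (swap i u) = wt w u.
Proof.
rewrite /wt /swap; case: ifP => ia.
  by have := sum_put (fun x => w x) be ia; rewrite wt_albe => /addIn.
case: ifP => ib //.
by have := sum_put (fun x => w x) al ib; rewrite wt_albe => /addIn.
Qed.

Lemma cnt_swap i u : (cnt (swap i u))%:Z = (cnt u)%:Z + P%:Z * drift i u.
Proof.
have cE v : cnt v = (\sum_x v x * 1)%N by apply: eq_bigr => x _; rewrite muln1.
have gE g : (\sum_c g c * 1 = \sum_c g c :> nat)%N by apply: eq_bigr => c _; rewrite muln1.
rewrite /drift /swap; case: ifP => ia.
  have := sum_put (fun=> 1%N) be ia; rewrite -!cE !gE; lia.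
case: ifP => ib; last by rewrite mulr0 addr0.
have := sum_put (fun=> 1%N) al ib; rewrite -!cE !gE; lia.
Qed.

Lemma drift_swap i j u : j != i -> drift j (swap i u) = drift j u.
Proof.
by move=> ji; rewrite /swap; case: ifP => _; [|case: ifP => _ //]; rewrite /drift !inst_put_other.
Qed.

Lemma drift_le1 i u : `|drift i u| <= 1.
Proof. by rewrite /drift; do 2![case: ifP => _ //]. Qed.

Variable (R : realType).

Variable (y : 'I_K -> R).
Hypothesis y0 : forall x, 0 < y x.

Let geom x := \sum_(h < H.+1) y x ^+ h.

Lemma geom_gt0 x : 0 < geom x.
Proof. by rewrite /geom big_ord_recl expr0 ltr_pwDl // sumr_ge0 // => h _; rewrite exprn_ge0 // ltW. Qed.

Definition inst_prob i := \prod_c (y (pos i c) ^+ al c / \sum_(h < H.+1) y (pos i c) ^+ h).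

(** Prescribing states only restricts the factor at each prescribed position to a single term, and
    these positions are distinct, so the sum still factors over the indices. *)
Lemma sum_inst (S : {set 'I_r}) :
  \sum_(u : {ffun 'I_K -> 'I_H.+1}) (\prod_x y x ^+ u x) * \prod_(i in S) (inst al i u)%:R =
  (\prod_x \sum_(h < H.+1) y x ^+ h) * \prod_(i in S) inst_prob i.
Proof.
pose SJ := finset.setX S [set: J].
pose img := [set pos ic.1 ic.2 | ic in SJ].
pose ok x (h : 'I_H.+1) := [forall ic in SJ, (pos ic.1 ic.2 == x) ==> (h == al ic.2)].
pose phi x h : R := y x ^+ (nat_of_ord h) * (ok x h)%:R.
transitivity (\sum_(u : {ffun 'I_K -> 'I_H.+1}) \prod_x phi x (u x)).
  apply: eq_bigr => u _; rewrite /phi big_split /=; congr (_ * _).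
  have [/forall_inP iS|/forall_inPn[i iS ni]] := boolP [forall i in S, inst al i u].
    rewrite !big1 // => [x _|i /iS -> //].
    suff -> : ok x (u x) by [].
    apply/forall_inP => -[i c]; rewrite !inE => /andP[/= /iS /forallP/(_ c)/eqP uE _].
    by apply/implyP => /eqP <-; apply/eqP.
  rewrite (bigD1 i) //= (negbTE ni) mul0r; move: ni => /forallPn[c nc].
  rewrite (bigD1 (pos i c)) //=.
  suff -> : ok (pos i c) (u (pos i c)) = false by rewrite mul0r.
  apply/negP => /forall_inP/(_ (i, c)); rewrite !inE iS /= eqxx (negbTE nc).
  by move=> /(_ isT).
have -> : \sum_(u : {ffun 'I_K -> 'I_H.+1}) \prod_x phi x (u x) = \prod_x \sum_h phi x h.
  by rewrite bigA_distr_bigA.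
pose psi x := (\sum_h phi x h) / geom x.
have -> : \prod_x \sum_h phi x h = (\prod_x geom x) * \prod_x psi x.
  rewrite -big_split; apply: eq_bigr => x _ /=.
  by rewrite /psi mulrC divfK // gt_eqF // geom_gt0.
congr (_ * _).
rewrite (bigID (fun x => x \in img)) /= [X in _ * X]big1 ?mulr1; last first.
  move=> x nx; rewrite /psi; suff -> : \sum_h phi x h = geom x.
    by rewrite mulfV // gt_eqF // geom_gt0.
  apply: eq_bigr => h _; rewrite /phi; suff -> : ok x h by rewrite mulr1.
  apply/forall_inP => ic icS; apply/implyP => /eqP pE; case/negP: nx.
  by rewrite -pE; apply: imset_f.
rewrite big_imset /=; last by move=> [i c] [i' c'] _ _ /pos_inj[/= -> ->].
have -> : \prod_(ic in SJ) psi (pos ic.1 ic.2) =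
  \prod_(i in S) \prod_(c in [set: J]) psi (pos i c).
  rewrite pair_big /=; apply: eq_bigl => -[i c]; by rewrite !inE.
apply: eq_bigr => i iS; rewrite /inst_prob; apply: eq_big => [c|c _]; first by rewrite inE.
rewrite /psi; congr (_ / _).
rewrite (bigD1 (al c)) //= big1 ?addr0.
  rewrite /phi; suff -> : ok (pos i c) (al c) by rewrite mulr1.
  apply/forall_inP => -[i' c'] _; apply/implyP => /eqP /= /pos_inj[_ ->] //.
move=> h hc; rewrite /phi; suff -> : ok (pos i c) h = false by rewrite mulr0.
apply/negP => /forall_inP/(_ (i, c)); rewrite !inE iS /= eqxx (negbTE hc).
by move=> /(_ isT).
Qed.

(* Under the Gibbs measure [\prod_x y x ^+ u x] the gadget states are independent,
   hence so are the events [inst al i]; this is the expectation of 2 to the minus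
   the number of those that occur. *)
Lemma sum_half_inst :
  \sum_(u : {ffun 'I_K -> 'I_H.+1}) (\prod_x y x ^+ u x) * \prod_i (1 - (inst al i u)%:R / 2) =
  (\prod_x \sum_(h < H.+1) y x ^+ h) * \prod_i (1 - inst_prob i / 2).
Proof.
pose cS (S : {set 'I_r}) : R := \prod_(i in S) (- 2^-1).
have dist (F : 'I_r -> R) :
    \prod_i (1 - F i / 2) = \sum_(S : {set 'I_r}) cS S * \prod_(i in S) F i.
  have := @bigA_distr R 0 1 *%R +%R _ (fun i => - (F i / 2)) (fun _ => 1).
  rewrite (eq_bigr (fun i => 1 - F i / 2)); last by move=> i _; rewrite addrC.
  move=> ->; apply: eq_bigr => S _; rewrite -big_split /= [RHS]big_mkcond /=.
  by apply: eq_bigr => i _; case: ifP => // _; rewrite mulNr mulrC.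
transitivity (\sum_(u : {ffun 'I_K -> 'I_H.+1}) \sum_(S : {set 'I_r})
    (\prod_x y x ^+ u x) * (cS S * \prod_(i in S) (inst al i u)%:R)).
  by apply: eq_bigr => u _; rewrite (dist (fun i => (inst al i u)%:R)) mulr_sumr.
rewrite exchange_big (dist inst_prob) mulr_sumr /=; apply: eq_bigr => S _.
rewrite mulrCA -sum_inst mulr_sumr; apply: eq_bigr => u _.
by rewrite mulrCA.
Qed.

(** Markov's inequality for 2 to the minus the number of instances, which is at least $2^{-R_0}$ on
    [A]. *)
Lemma few_instances_bound (R0 : nat) (A : {set {ffun 'I_K -> 'I_H.+1}}) :
  (forall u, u \in A -> (#|[set i | inst al i u]| <= R0)%N) ->
  \sum_(u in A) \prod_x y x ^+ u x <=
  2 ^+ R0 * (\prod_x \sum_(h < H.+1) y x ^+ h) * \prod_i (1 - inst_prob i / 2).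
Proof.
move=> AR; rewrite -mulrA -sum_half_inst mulr_sumr [leLHS]big_mkcond /=.
apply: ler_sum => u _.
have W0 : 0 <= \prod_x y x ^+ u x by apply: prodr_ge0 => x _; rewrite exprn_ge0 // ltW.
have -> : \prod_(i < r) (1 - (inst al i u)%:R / 2) = 2 ^- #|[set i | inst al i u]| :> R.
  rewrite -exprVn -prodr_const big_mkcond [RHS]big_mkcond; apply: eq_bigr => i _ /=.
  by rewrite inE; case: inst => /=; field.
case: ifP => [/AR cu|_]; last by rewrite !mulr_ge0 // ?invr_ge0 exprn_ge0.
rewrite mulrCA -[leLHS]mulr1 ler_wpM2l // -ler_pdivrMr ?invr_gt0 ?exprn_gt0 //.
by rewrite invrK mul1r ler_eXn2l // ltr1n.
Qed.

End Gadgets.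

(** * Gibbs weights *)

Section BoseTerms.
Variable (R : realType).
Implicit Types (a b u t : R).

Lemma expR_sub1_gt0 a : 0 < a -> 0 < expR a - 1.
Proof. by move=> a0; rewrite subr_gt0 expR_gt1. Qed.

Lemma sub1_expRN_gt0 a : 0 < a -> 0 < 1 - expR (- a).
Proof. by move=> a0; rewrite subr_gt0 expR_lt1 oppr_lt0. Qed.

(** The function $-\log(1 - e^{-x})$ is convex, and its tangent at [a] has slope $-1/(e^a - 1)$. *)
Lemma geometric_shift a b : 0 < a -> 0 < b ->
  (1 - expR (- a))^-1 <= (1 - expR (- b))^-1 * expR ((b - a) / (expR a - 1)).
Proof.
move=> a0 b0; have ea := expR_sub1_gt0 a0.
rewrite mulrC ler_pdivlMr ?sub1_expRN_gt0 // mulrC.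
apply: le_trans (expR_ge1Dx _).
have -> : (1 - expR (- b)) / (1 - expR (- a)) = 1 + (1 - expR (- (b - a))) / (expR a - 1).
  rewrite opprB expRD !expRN.
  have H1 : expR a != 0 by rewrite gt_eqF // expR_gt0.
  have H2 : expR b != 0 by rewrite gt_eqF // expR_gt0.
  have H3 : expR a - 1 != 0 by rewrite gt_eqF.
  move: (expR a) (expR b) {ea} H1 H2 H3 => x z H1 H2 H3.
  by field; rewrite H1 H2 H3.
rewrite lerD2l ler_wpM2r ?invr_ge0 ?(ltW ea) //.
have := expR_ge1Dx (- (b - a)); lra.
Qed.

Lemma expR_ge_pow4 u : 0 <= u -> (1 + u / 4) ^+ 4 <= expR u.
Proof.
move=> u0; have {2}-> : u = 4%:R * (u / 4) by field.
by rewrite expRM_natl lerXn2r ?nnegrE ?expR_ge0 ?expR_ge1Dx //; lra.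
Qed.

Lemma bose_ge u : 0 < u -> expR (- u) <= u / (expR u - 1).
Proof.
move=> u0; rewrite ler_pdivlMr ?expR_sub1_gt0 // mulrBr mulr1 -expRD addNr expR0.
have := expR_ge1Dx (- u); lra.
Qed.

Lemma bose_decay u : 0 < u -> u / (expR u - 1) <= 16 / (1 + u ^+ 2).
Proof.
move=> u0; rewrite ler_pdivrMr ?expR_sub1_gt0 // mulrAC ler_pdivlMr; last by rewrite ltr_pwDl // sqr_ge0.
have := expR_ge_pow4 (ltW u0); set e := expR u => He.
have : 16 * ((1 + u / 4) ^+ 4 - 1) <= 16 * (e - 1) by rewrite ler_pM2l // lerD2r.
apply: le_trans.
have -> : (1 + u / 4) ^+ 4 = 1 + u + 3 / 8 * u ^+ 2 + u ^+ 3 / 16 + u ^+ 4 / 256 by field.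
have u2 : 0 <= u ^+ 2 by rewrite exprn_ge0 // ltW.
have u4 : 0 <= u ^+ 4 by rewrite exprn_ge0 // ltW.
have -> : u * (1 + u ^+ 2) = u + u ^+ 3 by ring.
lra.
Qed.

(** The difference has a closed form whose numerator is at most $u(b-a)$ and whose denominator only
    decreases when both points move to $u/2$. The rest compares polynomials through
    [expR_ge_pow4]. *)
Lemma bose_diff u a b : 0 < u -> u / 2 <= a -> u / 2 <= b -> a <= b ->
  u / (expR a - 1) - u / (expR b - 1) <= (b - a) / u * (4096 / (1 + u ^+ 2)).
Proof.
move=> u0 ua ub ab.
pose s := u / 2; have s0 : 0 < s by rewrite divr_gt0.
have a0 : 0 < a by apply: lt_le_trans ua.
have b0 : 0 < b by apply: lt_le_trans ub.
have ea := expR_sub1_gt0 a0; have eb := expR_sub1_gt0 b0; have es := expR_sub1_gt0 s0.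
have nb := sub1_expRN_gt0 b0; have ns := sub1_expRN_gt0 s0.
have eb0 := expR_gt0 b.
have E1 : u / (expR a - 1) - u / (expR b - 1) =
   u * (1 - expR (- (b - a))) / ((expR a - 1) * (1 - expR (- b))).
  rewrite opprB expRD !expRN.
  have H1 : expR b != 0 by rewrite gt_eqF.
  have H2 : expR a - 1 != 0 by rewrite gt_eqF.
  have H3 : expR b - 1 != 0 by rewrite gt_eqF.
  move: (expR a) (expR b) H1 H2 H3 => x z H1 H2 H3.
  by field; rewrite H1 H2 H3.
rewrite E1.
apply: (@le_trans _ _ (u * (b - a) / ((expR s - 1) * (1 - expR (- s))))).
  apply: ler_pM.
  - apply: mulr_ge0; first exact: ltW.
    by rewrite subr_ge0 -expR0 ler_expR oppr_le0 subr_ge0.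
  - by rewrite invr_ge0 mulr_ge0 // ltW.
  - by rewrite ler_pM2l //; have := expR_ge1Dx (- (b - a)); lra.
  - rewrite lef_pV2 ?posrE ?mulr_gt0 //; apply: ler_pM.
    + exact: ltW.
    + exact: ltW.
    + by rewrite lerD2r ler_expR.
    + by rewrite lerB // ler_expR lerN2.
have -> : (b - a) / u * (4096 / (1 + u ^+ 2)) = u * (b - a) * (4096 / (u ^+ 2 * (1 + u ^+ 2))).
  have ? : 1 + u ^+ 2 != 0 by rewrite gt_eqF // ltr_pwDl // sqr_ge0.
  by field; apply/andP; split=> //; rewrite gt_eqF.
apply: ler_wpM2l; first by rewrite mulr_ge0 ?subr_ge0 // ltW.
have ns1 : s / (1 + s) <= 1 - expR (- s).
  rewrite expRN; have e1 := expR_ge1Dx s.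
  have s1 : 0 < 1 + s by lra.
  have : (expR s)^-1 <= (1 + s)^-1 by rewrite lef_pV2 ?posrE ?expR_gt0.
  have -> : s / (1 + s) = 1 - (1 + s)^-1 by field; rewrite gt_eqF.
  lra.
have es1 : s * (1 + 3 / 8 * s + s ^+ 2 / 16 + s ^+ 3 / 256) <= expR s - 1.
  have := expR_ge_pow4 (ltW s0).
  have -> : (1 + s / 4) ^+ 4 = 1 + s * (1 + 3 / 8 * s + s ^+ 2 / 16 + s ^+ 3 / 256) by field.
  lra.
have uE : u = 2 * s by rewrite /s; field.
have u2 : 0 < u ^+ 2 by rewrite exprn_gt0.
have u3 : 0 < 1 + u ^+ 2 by lra.
rewrite -[leLHS]mul1r ler_pdivrMr ?mulr_gt0 // mulrAC ler_pdivlMr ?mulr_gt0 // mul1r.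
set X := 1 + 3 / 8 * s + s ^+ 2 / 16 + s ^+ 3 / 256 in es1.
have s2 : 0 <= s ^+ 2 by rewrite exprn_ge0 // ltW.
have s3 : 0 <= s ^+ 3 by rewrite exprn_ge0 // ltW.
have X0 : 0 <= X by rewrite /X; lra.
apply: (@le_trans _ _ (4096 * (s * X * (s / (1 + s))))); last first.
  apply: ler_wpM2l; first exact: ler0n.
  apply: ler_pM => //; first by rewrite mulr_ge0 // ltW.
  by rewrite divr_ge0 ?(ltW s0) //; lra.
rewrite mulrA mulrA ler_pdivlMr; last by lra.
rewrite uE.
have -> : (2 * s) ^+ 2 * (1 + (2 * s) ^+ 2) * (1 + s) =
    s ^+ 2 * (4 * (1 + s + 4 * s ^+ 2 + 4 * s ^+ 3)) by ring.
have -> : 4096 * (s * X) * s = s ^+ 2 * (4096 * X) by ring.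
by rewrite ler_wpM2l // /X; lra.
Qed.

Lemma sum_decay (L : R) (K : nat) : 1 <= L ->
  \sum_(i < K) (1 + (i.+1%:R / L) ^+ 2)^-1 <= 2 * L.
Proof.
move=> L1; have L0 : 0 < L by apply: lt_le_trans L1.
(* This sharper form telescopes, because $L^2 + y^2 \ge (L+y)^2/2$. *)
suff : \sum_(i < K) (1 + (i.+1%:R / L) ^+ 2)^-1 <= 2 * L - 2 * L ^+ 2 / (L + K%:R).
  move/le_trans; apply; rewrite gerBl; apply: divr_ge0; last by rewrite addr_ge0 ?ler0n ?(ltW L0).
  by apply: mulr_ge0 => //; apply/exprn_ge0/ltW.
elim: K => [|K IH].
  by rewrite big_ord0 addr0 expr2 mulrA mulfK ?gt_eqF // subrr.
rewrite big_ord_recr /=; apply: le_trans (lerD IH (lexx _)) _.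
set x := L + K%:R; have x0 : 0 < x by rewrite ltr_wpDr.
have -> : L + K.+1%:R = x + 1 by rewrite -natr1 addrA.
have Kx : K.+1%:R = x + 1 - L by rewrite /x -natr1; ring.
have Lx : L <= x by rewrite lerDl.
rewrite -addrA lerD2l addrC -lerBrDr opprK.
have -> : - (2 * L ^+ 2 / (x + 1)) + 2 * L ^+ 2 / x = 2 * L ^+ 2 / (x * (x + 1)).
  by field; rewrite !gt_eqF //; lra.
have -> : (1 + (K.+1%:R / L) ^+ 2)^-1 = L ^+ 2 / (L ^+ 2 + K.+1%:R ^+ 2).
  have ? : L ^+ 2 + K.+1%:R ^+ 2 != 0 by rewrite gt_eqF // ltr_pwDl ?sqr_ge0 // exprn_gt0.
  have L2 : L ^+ 2 != 0 by rewrite gt_eqF // exprn_gt0.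
  by rewrite expr_div_n -{1}(divff L2) -mulrDl invf_div.
rewrite Kx [2 * L ^+ 2]mulrC -[L ^+ 2 * 2 / _]mulrA ler_wpM2l ?exprn_ge0 ?(ltW L0) //.
have x1 : 0 < x * (x + 1) by apply: mulr_gt0 => //; lra.
have y1 : 0 < L ^+ 2 + (x + 1 - L) ^+ 2 by rewrite ltr_pwDl ?sqr_ge0 // exprn_gt0.
rewrite -[leLHS]mul1r ler_pdivrMr // mulrAC ler_pdivlMr // mul1r.
have := sqr_ge0 (2 * L - x - 1).
have -> : (2 * L - x - 1) ^+ 2 = 2 * (L ^+ 2 + (x + 1 - L) ^+ 2) - (x + 1) ^+ 2 by ring.
have -> : (x + 1) ^+ 2 = x * (x + 1) + (x + 1) by ring.
lra.
Qed.

End BoseTerms.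

Lemma eq_ler (R : realType) (x y : R) : x = y -> x <= y.
Proof. by move->. Qed.

Lemma prod_1sub_ge (R : realType) (K : nat) (a : 'I_K -> R) :
  (forall i, 0 <= a i <= 1) -> 1 - \sum_i a i <= \prod_i (1 - a i).
Proof.
move=> a01; elim: K a a01 => [|K IH] a a01; first by rewrite !big_ord0 subr0.
rewrite !big_ord_recr /=.
have := IH (fun i => a (widen_ord (leqnSn K) i)) (fun i => a01 _).
set S := \sum_(i < K) _; set Q := \prod_(i < K) _ => SQ.
have /andP[a0 a1] := a01 ord_max.
have S0 : 0 <= S by apply: sumr_ge0 => i _; case/andP: (a01 (widen_ord (leqnSn K) i)).
apply: (@le_trans _ _ ((1 - S) * (1 - a ord_max))).
  have := mulr_ge0 S0 a0.
  have -> : (1 - S) * (1 - a ord_max) = 1 - S - a ord_max + S * a ord_max by ring.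
  lra.
by rewrite ler_wpM2r // subr_ge0.
Qed.

Section PartitionFunction.
Variables (R : realType) (w : nat -> nat).
Hypothesis w_gt0 : forall i, (0 < w i)%N.

Definition partfun (K : nat) (t : R) : R := \prod_(i < K) (1 - expR (- (t * (w i)%:R)))^-1.
(* The Gibbs mean of the weight, [- partfun' / partfun]. *)
Definition meanwt (K : nat) (t : R) : R := \sum_(i < K) (w i)%:R / (expR (t * (w i)%:R) - 1).

Let w0 i : 0 < (w i)%:R :> R. Proof. by rewrite ltr0n. Qed.

Lemma partfun_gt0 K t : 0 < t -> 0 < partfun K t.
Proof. by move=> t0; apply: prodr_gt0 => i _; rewrite invr_gt0 sub1_expRN_gt0 // mulr_gt0. Qed.

(** This is log-convexity of the partition function, the input for the exponential tail bounds. *)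
Lemma partfun_shift K t t' : 0 < t -> 0 < t' ->
  partfun K t' <= partfun K t * expR ((t - t') * meanwt K t').
Proof.
move=> t0 t'0; rewrite /meanwt mulr_sumr expR_sum -big_split /=.
apply: ler_prod => i _; apply/andP; split.
  by rewrite invr_ge0 ltW // sub1_expRN_gt0 // mulr_gt0.
have := geometric_shift (mulr_gt0 t'0 (w0 i)) (mulr_gt0 t0 (w0 i)).
by rewrite -mulrBl mulrA.
Qed.

Lemma meanwt_continuous K (t : R) : 0 < t -> (meanwt K x @[x --> t] --> meanwt K t)%classic.
Proof.
move=> t0; rewrite /meanwt; elim: K => [|K IH].
  under eq_fun => x do rewrite big_ord0.
  by rewrite big_ord0; exact: cvg_cst.
under eq_fun => x do rewrite big_ord_recr /=.
rewrite big_ord_recr /=; apply: cvgD; first exact: IH.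
apply: cvgM; first exact: cvg_cst.
apply: cvgV; first by rewrite gt_eqF // expR_sub1_gt0 // mulr_gt0.
apply: cvgB; last exact: cvg_cst.
apply: (@continuous_comp _ _ _ (fun x : R => x * (w K)%:R) expR); last exact: continuous_expR.
apply: cvgM; last exact: cvg_cst.
exact: cvg_id.
Qed.

Section Weights.
Variables (K H : nat).
Implicit Type u : {ffun 'I_K -> 'I_H.+1}.

Lemma prod_expR_wt (t : R) u :
  \prod_(x < K) expR (- (t * (w x)%:R)) ^+ u x = expR (- (t * (wt w u)%:R)).
Proof.
rewrite /wt natr_sum mulr_sumr -sumrN expR_sum; apply: eq_bigr => x _.
by rewrite -expRM_natl natrM mulrN mulrCA.
Qed.

Lemma sum_expR_wt (t : R) :
  \sum_(u : {ffun 'I_K -> 'I_H.+1}) expR (- (t * (wt w u)%:R)) =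
  \prod_(x < K) \sum_(h < H.+1) expR (- (t * (w x)%:R)) ^+ h.
Proof.
rewrite bigA_distr_bigA; apply: eq_bigr => u _.
by rewrite -prod_expR_wt.
Qed.

Lemma geom_sumE (y : R) : y < 1 ->
  \sum_(h < H.+1) y ^+ h = (1 - y ^+ H.+1) * (1 - y)^-1.
Proof.
move=> y1; have ny : 1 - y != 0 by rewrite gt_eqF // subr_gt0.
by apply: (mulfI ny); rewrite [RHS]mulrC divfK // -[RHS]opprB subrX1 -mulNr opprB.
Qed.

Lemma geom_sum_le (y : R) : 0 <= y -> y < 1 -> \sum_(h < H.+1) y ^+ h <= (1 - y)^-1.
Proof.
move=> y0 y1; rewrite geom_sumE // ler_piMl ?invr_ge0 ?subr_ge0 ?(ltW y1) //.
by rewrite gerBl exprn_ge0.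
Qed.

Lemma sum_expR_wt_le t : 0 < t ->
  \sum_(u : {ffun 'I_K -> 'I_H.+1}) expR (- (t * (wt w u)%:R)) <= partfun K t.
Proof.
move=> t0; rewrite sum_expR_wt; apply: ler_prod => x _; apply/andP; split.
  by apply: sumr_ge0 => h _; rewrite exprn_ge0 // expR_ge0.
by apply: geom_sum_le; rewrite ?expR_ge0 // expR_lt1 oppr_lt0 mulr_gt0.
Qed.

(** Capping a multiplicity at [H] costs its factor a proportion of at most $1/(1+tH)$, and the [K]
    losses add up to at most one half. *)
Lemma sum_expR_wt_ge t : 0 < t -> 2 * K%:R <= t * H%:R ->
  partfun K t / 2 <= \sum_(u : {ffun 'I_K -> 'I_H.+1}) expR (- (t * (wt w u)%:R)).
Proof.
move=> t0 tH; rewrite sum_expR_wt.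
under [leRHS]eq_bigr => x _.
  rewrite geom_sumE; last by rewrite expR_lt1 oppr_lt0 mulr_gt0.
  over.
rewrite big_split /= mulrC ler_wpM2r ?(ltW (partfun_gt0 _ _)) //.
apply: le_trans (prod_1sub_ge _); last first.
  move=> x; rewrite exprn_ge0 ?expR_ge0 //= exprn_ile1 ?expR_ge0 //.
  by rewrite -expR0 ler_expR oppr_le0 mulr_ge0 // ltW.
have bd (x : 'I_K) : expR (- (t * (w x)%:R)) ^+ H.+1 <= (1 + t * H%:R)^-1.
  have tH0 : 0 <= t * H%:R by rewrite mulr_ge0 ?ler0n // ltW.
  rewrite -expRM_natl mulrN expRN lef_pV2 ?posrE ?expR_gt0 //; last by lra.
  apply: le_trans (expR_ge1Dx _) _; rewrite ler_expR mulrCA.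
  by rewrite ler_pM2l // -natrM ler_nat; have := w_gt0 x; nia.
have : \sum_(x < K) expR (- (t * (w x)%:R)) ^+ H.+1 <= \sum_(x < K) (1 + t * H%:R)^-1.
  by apply: ler_sum => x _; exact: bd.
rewrite sumr_const card_ord -[(1 + t * H%:R)^-1 *+ K]mulr_natl => S.
have : K%:R / (1 + t * H%:R) <= 2^-1.
  rewrite ler_pdivrMr; last by have := ler0n R K; lra.
  lra.
move=> S2; have := le_trans S S2; set s := \sum_(x < K) _; lra.
Qed.

End Weights.

Variables (d : nat) (c0 C0 : R).
Hypothesis d0 : (0 < d)%N.
Hypothesis c00 : 0 < c0.
Hypothesis C00 : 0 < C0.
Hypothesis growth : forall i, c0 * i.+1%:R ^+ d <= (w i)%:R <= C0 * i.+1%:R ^+ d.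

(** This reduces degree [d] to the summable linear case: for $x \le 1$ the right side is at least 1,
    and for $x > 1$ one has $x^d \ge x$. *)
Lemma decay_weight (tau kap L : R) (i : nat) : 1 <= L -> 0 < kap -> kap <= 1 -> kap <= tau * c0 ->
  (1 + (tau / L ^+ d * (w i)%:R) ^+ 2)^-1 <= 2 / kap ^+ 2 * (1 + (i.+1%:R / L) ^+ 2)^-1.
Proof.
move=> L1 k0 k1 kt.
have L0 : 0 < L := lt_le_trans ltr01 L1.
have Ld : 0 < L ^+ d by rewrite exprn_gt0.
have tau0 : 0 < tau by rewrite -(pmulr_lgt0 _ c00); apply: lt_le_trans kt.
set x := i.+1%:R / L; have x0 : 0 < x by rewrite divr_gt0 // ltr0n.
set v := tau / L ^+ d * (w i)%:R.
have vx : kap * x ^+ d <= v.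
  rewrite /x /v expr_div_n mulrA [leRHS]mulrAC ler_wpM2r ?invr_ge0 ?(ltW Ld) //.
  apply: (@le_trans _ _ (tau * c0 * i.+1%:R ^+ d)).
    by rewrite ler_wpM2r // exprn_ge0 // ler0n.
  by rewrite -mulrA ler_pM2l //; case/andP: (growth i).
have v0 : 0 <= v by apply: le_trans vx; rewrite mulr_ge0 ?exprn_ge0 // ltW.
have k2 : 0 < kap ^+ 2 by rewrite exprn_gt0.
have x2 : 0 <= x ^+ 2 by rewrite exprn_ge0 // ltW.
have v2 : 0 <= v ^+ 2 by rewrite exprn_ge0.
rewrite mulrAC -invf_div lef_pV2 ?posrE; last 2 first.
- by rewrite ltr_pwDl.
- by rewrite divr_gt0 // ?mulr_gt0 ?invr_gt0 // ltr_pwDl.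
rewrite invf_div mulrA ler_pdivrMr ?ltr0n //.
have [xle|xgt] := leP x 1.
  have : x ^+ 2 <= 1 by rewrite exprn_ile1 // ltW.
  have : kap ^+ 2 <= 1 by rewrite exprn_ile1 // ltW.
  nra.
have xd : x <= x ^+ d by rewrite -[leLHS]expr1; apply: ler_weXn2l => //; exact: ltW.
have kv : kap * x <= v by apply: le_trans vx; rewrite ler_pM2l.
have : (kap * x) ^+ 2 <= v ^+ 2 by rewrite lerXn2r ?nnegrE // mulr_ge0 // ltW.
have : kap ^+ 2 <= 1 by rewrite exprn_ile1 // ltW.
rewrite exprMn; nra.
Qed.

Lemma sum_decay_weight (tau kap L : R) (K : nat) :
  1 <= L -> 0 < kap -> kap <= 1 -> kap <= tau * c0 ->
  \sum_(i < K) (1 + (tau / L ^+ d * (w i)%:R) ^+ 2)^-1 <= 4 / kap ^+ 2 * L.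
Proof.
move=> L1 k0 k1 kt.
apply: (@le_trans _ _ (\sum_(i < K) 2 / kap ^+ 2 * (1 + (i.+1%:R / L) ^+ 2)^-1)).
  by apply: ler_sum => i _; exact: decay_weight.
rewrite -mulr_sumr; apply: le_trans (ler_wpM2l _ (sum_decay K L1)) _.
  by rewrite divr_ge0 // exprn_ge0 // ltW.
by rewrite mulrA; apply: eq_ler; field; rewrite gt_eqF.
Qed.

Lemma meanwt_le (tau kap L : R) (K : nat) :
  1 <= L -> 0 < kap -> kap <= 1 -> kap <= tau * c0 -> 0 < tau ->
  tau / L ^+ d * meanwt K (tau / L ^+ d) <= 64 / kap ^+ 2 * L.
Proof.
move=> L1 k0 k1 kt tau0.
have t0 : 0 < tau / L ^+ d by rewrite divr_gt0 // exprn_gt0 // (lt_le_trans ltr01).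
set t := tau / L ^+ d in t0 *.
have := sum_decay_weight K L1 k0 k1 kt; rewrite -/t => S.
apply: (@le_trans _ _ (16 * (4 / kap ^+ 2 * L))); last by apply: eq_ler; field; rewrite gt_eqF.
apply: le_trans (ler_wpM2l _ S) => //; rewrite /meanwt !mulr_sumr; apply: ler_sum => i _.
by rewrite mulrA bose_decay // mulr_gt0.
Qed.

(** Only the parts of index up to $L$ are kept. For them $t w$ is at most [tau * C0], and there are
    at least $L/2$ of them. *)
Lemma meanwt_ge (tau L : R) (K : nat) :
  1 <= L -> 0 < tau -> (Num.truncn L <= K)%N ->
  L / 2 * expR (- (tau * C0)) <= tau / L ^+ d * meanwt K (tau / L ^+ d).
Proof.
move=> L1 tau0 LK.
have L0 : 0 < L := lt_le_trans ltr01 L1.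
have Ld : 0 < L ^+ d by rewrite exprn_gt0.
have t0 : 0 < tau / L ^+ d by rewrite divr_gt0.
set t := tau / L ^+ d in t0 *.
have /andP[m1 m2] := truncn_itv (ltW L0).
rewrite /meanwt mulr_sumr.
have termge0 (i : nat) : 0 <= t * ((w i)%:R / (expR (t * (w i)%:R) - 1)).
  have tw : 0 < t * (w i)%:R by rewrite mulr_gt0.
  by rewrite mulrA; apply: divr_ge0; apply: ltW => //; exact: expR_sub1_gt0.
rewrite -(big_mkord xpredT (fun i => t * ((w i)%:R / (expR (t * (w i)%:R) - 1)))).
rewrite (big_cat_nat (leq0n _) LK) /= ler_wpDr //; first exact: sumr_ge0.
apply: (@le_trans _ _ (\sum_(0 <= i < Num.truncn L) expR (- (tau * C0)))).
  rewrite big_const_nat subn0 iter_addr addr0 -[expR _ *+ _]mulr_natl ler_wpM2r ?expR_ge0 //.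
  have : 1 <= (Num.truncn L)%:R :> R.
    rewrite ler1n lt0n; apply/negP => /eqP m0; move: m2; rewrite m0; lra.
  move: m2; rewrite -natr1; lra.
rewrite [leLHS]big_nat [leRHS]big_nat; apply: ler_sum => i /andP[_ im].
rewrite mulrA; apply: le_trans (bose_ge _); last by rewrite mulr_gt0.
rewrite ler_expR lerN2 /t mulrAC -mulrA ler_pM2l // ler_pdivrMr //.
apply: le_trans (proj2 (andP (growth i))) _; rewrite ler_pM2l //.
rewrite lerXn2r ?nnegrE ?ler0n ?(ltW L0) //.
by apply: le_trans m1; rewrite ler_nat.
Qed.

(** The exponential tail bounds evaluate the mean at $(1 \pm \eta) t$. This lemma keeps it within
    $O(\eta L)$ of the mean at $t$, after multiplication by $t$. *)
Lemma meanwt_regular (tau kap L eta : R) (K : nat) :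
  1 <= L -> 0 < kap -> kap <= 1 -> kap <= tau * c0 -> 0 < tau ->
  0 < eta -> eta <= 2^-1 ->
  let t := tau / L ^+ d in
  t * meanwt K ((1 - eta) * t) <= t * meanwt K t + eta * (16384 / kap ^+ 2 * L) /\
  t * meanwt K t - eta * (16384 / kap ^+ 2 * L) <= t * meanwt K ((1 + eta) * t).
Proof.
move=> L1 k0 k1 kt tau0 e0 e1 t.
have t0 : 0 < t by rewrite divr_gt0 // exprn_gt0 // (lt_le_trans ltr01).
have := sum_decay_weight K L1 k0 k1 kt; rewrite -/t => S.
have {}S : \sum_(i < K) eta * (4096 / (1 + (t * (w i)%:R) ^+ 2)) <= eta * (16384 / kap ^+ 2 * L).
  rewrite -mulr_sumr ler_pM2l // -mulr_sumr.
  apply: le_trans (ler_wpM2l _ S) _; first exact: ler0n.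
  by apply: eq_ler; field; rewrite gt_eqF.
have tw i : 0 < t * (w i)%:R by rewrite mulr_gt0.
split.
  rewrite -lerBlDl; apply: le_trans S; rewrite /meanwt !mulr_sumr -sumrB; apply: ler_sum => i _.
  pose u := t * (w i)%:R; have u0 : 0 < u := tw i.
  rewrite -[(1 - eta) * t * _]mulrA [t * (_ / _)]mulrA [X in _ - X]mulrA -/u.
  have := @bose_diff R u ((1 - eta) * u) u u0.
  have -> : (u - (1 - eta) * u) / u = eta by field; rewrite gt_eqF.
  apply; nra.
rewrite lerBlDr -lerBlDl; apply: le_trans S; rewrite /meanwt !mulr_sumr -sumrB; apply: ler_sum => i _.
pose u := t * (w i)%:R; have u0 : 0 < u := tw i.
rewrite -[(1 + eta) * t * _]mulrA [t * (_ / _)]mulrA [X in _ - X]mulrA -/u.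
have := @bose_diff R u u ((1 + eta) * u) u0.
have -> : ((1 + eta) * u - u) / u = eta by field; rewrite gt_eqF.
apply; nra.
Qed.

(* At [t = tau_min / L ^+ d] the mean weight exceeds [L ^+ d.+1], by [meanwt_ge];
   at [t = tau_max / L ^+ d] it is at most half of that, by [meanwt_le]. *)
Definition tau_min : R := Num.min C0^-1 (expR (- 1) / 2).
Definition tau_max : R := Num.max 128 c0^-1.

Lemma tau_min_gt0 : 0 < tau_min.
Proof. by rewrite lt_min invr_gt0 C00 divr_gt0 // expR_gt0. Qed.

Lemma tau_min_le_max : tau_min <= tau_max.
Proof.
apply: (@le_trans _ _ 1); last by rewrite le_max ler1n.
rewrite ge_min; apply/orP; right.
have : expR (- 1) <= 1 :> R by rewrite -[leRHS]expR0 ler_expR; lra.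
lra.
Qed.

(** By the intermediate value theorem. The factor [1 - eps] leaves room so that the bulk of the
    weights falls below [n], where monotonicity of the count applies. *)
Lemma meanwt_hit (L eps : R) (K : nat) : 1 <= L -> (Num.truncn L <= K)%N ->
  0 <= eps -> eps <= 2^-1 ->
  exists2 tau, tau_min <= tau <= tau_max & meanwt K (tau / L ^+ d) = L ^+ d.+1 * (1 - eps).
Proof.
move=> L1 LK e0 e1.
have L0 : 0 < L := lt_le_trans ltr01 L1.
have Ld : 0 < L ^+ d by rewrite exprn_gt0.
have t10 := tau_min_gt0.
have Ld1 : 0 < L ^+ d.+1 by rewrite exprn_gt0.
have low : L ^+ d.+1 <= meanwt K (tau_min / L ^+ d).
  have := meanwt_ge L1 t10 LK.
  have E : expR (- 1) <= expR (- (tau_min * C0)).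
    rewrite ler_expR lerN2 -ler_pdivlMr // div1r /tau_min ge_min lexx //.
  have T : tau_min <= expR (- 1) / 2 by rewrite /tau_min ge_min lexx orbT.
  move=> H; have : L * tau_min <= tau_min / L ^+ d * meanwt K (tau_min / L ^+ d).
    apply: le_trans H; rewrite -mulrA ler_pM2l //; apply: le_trans T _.
    by rewrite mulrC ler_wpM2l // invr_ge0.
  rewrite mulrAC ler_pdivlMr // [L * _]mulrC -mulrA -exprS.
  by rewrite ler_pM2l.
have high : meanwt K (tau_max / L ^+ d) <= L ^+ d.+1 * 2^-1.
  have t20 : 0 < tau_max := lt_le_trans t10 tau_min_le_max.
  have kc : 1 <= tau_max * c0 by rewrite -ler_pdivrMr // div1r /tau_max le_max lexx orbT.
  have := meanwt_le K L1 ltr01 (lexx 1) kc t20.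
  rewrite expr1n divr1 mulrAC ler_pdivrMr // -mulrA -exprS => H.
  have T : 128 <= tau_max by rewrite /tau_max le_max lexx.
  rewrite -(ler_pM2l t20); apply: le_trans H _.
  have := ltW Ld1; nra.
have [||tau tI tE] := @IVT R (fun tau => meanwt K (tau / L ^+ d)) tau_min tau_max
  (L ^+ d.+1 * (1 - eps)) tau_min_le_max.
- apply: continuous_in_subspaceT => x; rewrite inE /= in_itv /= => /andP[x1 _].
  apply: (@continuous_comp _ _ _ (fun x : R => x / L ^+ d) (meanwt K)).
    by apply: cvgM; [exact: cvg_id | exact: cvg_cst].
  by apply: meanwt_continuous; rewrite divr_gt0 // (lt_le_trans t10).
- apply/andP; split.
    rewrite ge_min; apply/orP; right; apply: le_trans high _.
    by rewrite ler_pM2l //; lra.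
  rewrite le_max; apply/orP; left; apply: le_trans low.
  rewrite -[leRHS]mulr1 ler_pM2l //; lra.
by exists tau => //; move: tI; rewrite in_itv.
Qed.

End PartitionFunction.

Lemma sum_ord_widen0 (m M : nat) (F : nat -> nat) : (m <= M)%N ->
  (forall i, (m <= i)%N -> F i = 0%N) -> (\sum_(i < m) F i = \sum_(i < M) F i)%N.
Proof.
move=> mM F0; rewrite -!(big_mkord xpredT) (big_cat_nat (leq0n m) mM) /=.
by rewrite [X in _ = (_ + X)%N]big_nat_cond [X in _ = (_ + X)%N]big1 ?addn0 // => i /andP[/andP[/F0 ->]].
Qed.

(** * A lower bound for the number of partitions of [n] *)

Section CardOfwtLower.
Variables (R : realType) (w : nat -> nat).
Hypothesis w_gt0 : forall i, (0 < w i)%N.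
Variables (N Cs : nat).
Hypothesis semigroup : forall h, (Cs <= h)%N ->
  exists e : nat -> nat, (\sum_(i < N) e i * w i = h)%N.

Definition ofwt (K H q : nat) : {set {ffun 'I_K -> 'I_H.+1}} := [set u | wt w u == q].

(* Completing a partition of [q] by fixed multiplicities of total weight [n - q]
   is injective. *)
Lemma card_ofwt_mono K H n q : (forall i, (K <= i)%N -> (n < w i)%N) -> (n <= H)%N ->
  (q + Cs <= n)%N -> (#|ofwt K H q| <= #|ofwt K H n|)%N.
Proof.
move=> Kn nH qn.
have [|e eE] := semigroup (h := (n - q)%N).
  by rewrite leq_subRL //; apply: leq_trans qn; exact: leq_addr.
(* Cutting at [K] loses nothing: an index from [K] on carries a part larger than [n], so its
   multiplicity in [e] is 0. *)
pose e' i := if (i < N)%N && (i < K)%N then e i else 0%N.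
have e'E : (\sum_(i < K) e' i * w i = n - q)%N.
  pose F i := (e' i * w i)%N.
  have FE : (\sum_(i < N) F i = n - q)%N.
    rewrite -[RHS]eE; apply: eq_bigr => i _; rewrite /F /e' ltn_ord /=.
    case: ltnP => // Ki; have := Kn _ Ki; rewrite ltnNge => /negP.
    case: (posnP (e i)) => [->//|ei]; case.
    apply: (@leq_trans (n - q)); last exact: leq_subr.
    rewrite -eE (bigD1 i) //=; apply: leq_trans (leq_addr _ _); exact: leq_pmull.
  rewrite -FE (@sum_ord_widen0 K (maxn K N) F) ?leq_maxl //; last first.
    by move=> i Ki; rewrite /F /e' [(i < K)%N]ltnNge Ki andbF.
  apply/esym/sum_ord_widen0; first exact: leq_maxr.
  by move=> i Ni; rewrite /F /e' ltnNge Ni.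
pose phi (u : {ffun 'I_K -> 'I_H.+1}) : {ffun 'I_K -> 'I_H.+1} :=
  [ffun x => inord (u x + e' x)].
have wtu u : u \in ofwt K H q -> (\sum_x (u x + e' x) * w x = n)%N.
  rewrite inE => /eqP wu.
  rewrite (eq_bigr (fun x : 'I_K => u x * w x + e' x * w x)%N); last by move=> x _; rewrite mulnDl.
  rewrite big_split /= e'E -/(wt w u) wu subnKC //.
  by apply: leq_trans qn; exact: leq_addr.
have phiE u x : u \in ofwt K H q -> phi u x = (u x + e' x)%N :> nat.
  move=> uq; rewrite ffunE inordK // ltnS; apply: leq_trans nH.
  rewrite -(wtu u uq) (bigD1 x) //=; apply: leq_trans (leq_addr _ _).
  exact: leq_pmulr.
rewrite -(@card_in_imset _ _ phi); last first.
  move=> u v uq vq uv; apply/ffunP => x; apply: val_inj => /=.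
  by have := phiE u x uq; rewrite uv phiE // => /addIn.
apply/subset_leq_card/fintype.subsetP => _ /imsetP[u uq ->]; rewrite inE; apply/eqP.
by rewrite -(wtu u uq); apply: eq_bigr => x _; rewrite phiE.
Qed.

Hypothesis Cs0 : (0 < Cs)%N.
Variables (d : nat) (c0 C0 : R).
Hypothesis d0 : (0 < d)%N.
Hypothesis c00 : 0 < c0.
Hypothesis C00 : 0 < C0.
Hypothesis growth : forall i, c0 * i.+1%:R ^+ d <= (w i)%:R <= C0 * i.+1%:R ^+ d.

Local Notation tau_min := (tau_min C0).
Local Notation tau_max := (tau_max c0).

Lemma truncn_le_index K n (L : R) : 1 <= L -> C0 <= L -> n%:R = L ^+ d.+1 ->
  (forall i, (K <= i)%N -> (n < w i)%N) -> (Num.truncn L <= K)%N.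
Proof.
move=> L1 LC nL Kn; rewrite leqNgt; apply/negP => KL.
have L0 : 0 < L := lt_le_trans ltr01 L1.
have /andP[m1 _] := truncn_itv (ltW L0).
have := Kn K (leqnn K); rewrite ltnNge => /negP; apply.
rewrite -(ler_nat R) nL; apply: le_trans (proj2 (andP (growth K))) _.
rewrite exprS; apply: ler_pM => //; rewrite ?exprn_ge0 ?ler0n ?(ltW C00) //.
rewrite lerXn2r ?nnegrE ?ler0n ?(ltW L0) //.
by apply: le_trans m1; rewrite ler_nat.
Qed.

(** Since [Cs] is positive, the weights concerned take at most [n] values, and each value has at
    most as many partitions as [n] by [card_ofwt_mono]. *)
Lemma sum_expR_mid_le K H n (t lo : R) : (forall i, (K <= i)%N -> (n < w i)%N) -> (n <= H)%N ->
  0 < t ->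
  \sum_(u : {ffun 'I_K -> 'I_H.+1} | (lo <= (wt w u)%:R) && (wt w u + Cs <= n)%N)
     expR (- (t * (wt w u)%:R)) <=
  expR (- (t * lo)) * (n%:R * #|ofwt K H n|%:R).
Proof.
move=> Kn nH t0.
apply: (@le_trans _ _ (\sum_(u : {ffun 'I_K -> 'I_H.+1} | (wt w u + Cs <= n)%N) expR (- (t * lo)))).
  rewrite big_mkcondl /=; apply: ler_sum => u _; case: ifP => [lou|_]; last exact: expR_ge0.
  by rewrite ler_expR lerN2 ler_pM2l.
rewrite sumr_const -[_ *+ _]mulr_natr ler_wpM2l ?expR_ge0 // -natrM ler_nat.
rewrite -sum1_card.
rewrite (partition_big (fun u : {ffun 'I_K -> 'I_H.+1} => inord (wt w u) : 'I_n.-1.+1)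
   (fun q : 'I_n.-1.+1 => (q + Cs <= n)%N)) /=; last first.
  move=> u; rewrite unfold_in => un; rewrite inordK //; lia.
apply: (@leq_trans (\sum_(q < n.-1.+1 | (q + Cs <= n)%N) #|ofwt K H n|)).
  apply: leq_sum => q qn; apply: leq_trans (card_ofwt_mono Kn nH qn).
  rewrite -sum1_card [leqLHS]big_mkcond [leqRHS]big_mkcond /=; apply: leq_sum => u _.
  rewrite inE unfold_in; case: ifP => // /andP[un /eqP qE].
  by rewrite -qE inordK ?eqxx //; lia.
rewrite sum_nat_const leq_mul2r; apply/orP.
case: n {Kn nH} => [|n]; last by right; apply: leq_trans (max_card _) _; rewrite card_ord.
right; rewrite leqn0; apply/eqP/eq_card0 => q; rewrite unfold_in.
apply/negbTE; rewrite -ltnNge; lia.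
Qed.

(** At least half of the partition function survives the cap [H]. Each of the two tails outside
    $[(1-2\epsilon)n, n - C_s]$ takes at most an eighth, so the window keeps a quarter, to which
    [sum_expR_mid_le] applies. *)
Lemma card_ofwt_lower (eps : R) : 0 < eps -> eps <= 4^-1 ->
  exists2 L0 : R, 1 <= L0 & forall (L : R) n K, L0 <= L -> n%:R = L ^+ d.+1 ->
  (forall i, (K <= i)%N -> (n < w i)%N) ->
  exists2 tau, tau_min <= tau <= tau_max &
  exists H1, forall H, (H1 <= H)%N ->
  expR ((1 - 2 * eps) * (tau * L)) * partfun w K (tau / L ^+ d) <= 4 * n%:R * #|ofwt K H n|%:R.
Proof.
move=> e0 e1.
have t10 : 0 < tau_min := tau_min_gt0 C00.
have t12 := tau_min_le_max c0 C0.
have t20 : 0 < tau_max := lt_le_trans t10 t12.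
pose kap := Num.min 1 (tau_min * c0).
have k0 : 0 < kap by rewrite lt_min ltr01 mulr_gt0.
have k1 : kap <= 1 by rewrite ge_min lexx.
have kt1 : kap <= tau_min * c0 by rewrite ge_min lexx orbT.
have [A A0 reg] : exists2 A : R, 0 <= A & forall (L tau eta : R) K, 1 <= L -> tau_min <= tau ->
    0 < eta -> eta <= 2^-1 -> let t := tau / L ^+ d in
    t * meanwt w K ((1 - eta) * t) <= t * meanwt w K t + eta * (A * L) /\
    t * meanwt w K t - eta * (A * L) <= t * meanwt w K ((1 + eta) * t).
  exists (16384 / kap ^+ 2).
    by apply: divr_ge0; [exact: ler0n | apply/exprn_ge0/ltW].
  move=> L tau eta K L1 tt he0 he1; have kt : kap <= tau * c0 by apply: le_trans kt1 _; rewrite ler_pM2r.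
  exact: (meanwt_regular w_gt0 d0 c00 growth K L1 k0 k1 kt (lt_le_trans t10 tt) he0 he1).
pose C2 := (1 + A) / tau_min.
have C20 : 0 < C2 by apply: divr_gt0 => //; exact: ltr_wpDr.
(* Small enough that passing from $t$ to $(1 \pm \eta) t$ moves $t$ times the mean by at most
   $\epsilon\nu/2$, half of the gap to the ends of the window, where $\nu = tn$. *)
pose eta := Num.min 2^-1 (eps / (2 * C2)).
have eta0 : 0 < eta by rewrite lt_min invr_gt0 ltr0n divr_gt0 // mulr_gt0.
have eta1 : eta <= 2^-1 by rewrite ge_min lexx.
have etaC : eta * C2 <= eps / 2.
  rewrite -ler_pdivlMr // /eta ge_min; apply/orP; right.
  by rewrite invfM mulrA.
(* The last term gives $\eta\epsilon\nu/2 \ge 8 + \eta\tau_{max} C_s$, so both tail exponents are at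
   most $-8$, and $e^{-8} \le 1/8$. *)
pose L0 := Num.max (Num.max 1 C0) ((8 + eta * tau_max * Cs%:R) / (eta * eps * tau_min / 2)).
exists L0; first by rewrite !le_max lexx.
move=> L n K; rewrite !ge_max => /andP[/andP[L1 LC] LL] nL Kn.
have Lp : 0 < L := lt_le_trans ltr01 L1.
have LK := truncn_le_index L1 LC nL Kn.
have e2 : eps <= 2^-1 by apply: le_trans e1 _; lra.
have [tau tauI meanwtE] := meanwt_hit w_gt0 d0 c00 C00 growth L1 LK (ltW e0) e2.
exists tau => //; have /andP[taul taur] := tauI.
have tau0 : 0 < tau := lt_le_trans t10 taul.
have Ld : 0 < L ^+ d by rewrite exprn_gt0.
set t := tau / L ^+ d in meanwtE *.
have t0 : 0 < t by rewrite divr_gt0.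
set nu := tau * L.
have tn : t * n%:R = nu by rewrite nL /t exprSr mulrA divfK // gt_eqF.
have nu1 : tau_min * L <= nu by rewrite ler_pM2r.
have nu0 : 0 < nu by rewrite mulr_gt0.
have tNb : t * meanwt w K t = nu * (1 - eps) by rewrite meanwtE -nL mulrA tn.
have AL : A * L <= C2 * nu.
  apply: (@le_trans _ _ (C2 * (tau_min * L))); last by rewrite ler_pM2l.
  by rewrite mulrA divfK ?gt_eqF // ler_pM2r // lerDr.
have [] := reg L tau eta K L1 taul eta0 eta1; rewrite -/t tNb.
set X1 := t * meanwt w K _; set X2 := t * meanwt w K _ => X1u X2l.
have etaAL : eta * (A * L) <= eps / 2 * nu.
  apply: (@le_trans _ _ (eta * (C2 * nu))); first by rewrite ler_pM2l.
  by rewrite mulrA ler_pM2r.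
have tt2 : t <= tau_max.
  apply: le_trans taur; rewrite ler_pdivrMr // ler_peMr ?(ltW tau0) //.
  exact: exprn_ege1.
have big : 8 + eta * tau_max * Cs%:R <= eta * eps * nu / 2.
  have E : 0 < eta * eps * tau_min / 2 by rewrite !mulr_gt0 // invr_gt0.
  move: LL; rewrite ler_pdivrMr // => /le_trans; apply.
  have -> : L * (eta * eps * tau_min / 2) = eta * eps / 2 * (tau_min * L) by field.
  have -> : eta * eps * nu / 2 = eta * eps / 2 * nu by field.
  by rewrite ler_pM2l // !mulr_gt0 // invr_gt0.
have e8 : expR (- 8) <= 8^-1 :> R.
  rewrite expRN lef_pV2 ?posrE ?expR_gt0 ?ltr0n //.
  by apply: le_trans (expR_ge1Dx _); rewrite lerDr.
have Z0 : 0 < partfun w K t := partfun_gt0 w_gt0 K t0.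
exists (maxn n (Num.truncn (2 * K%:R / t)).+1) => H; rewrite geq_max => /andP[nH KH].
have tH : 2 * K%:R <= t * H%:R.
  have Kt0 : 0 <= 2 * K%:R / t by rewrite !mulr_ge0 ?invr_ge0 ?ler0n // ltW.
  rewrite [t * _]mulrC -ler_pdivrMr //; have /andP[_ /ltW tr] := truncn_itv Kt0.
  by apply: le_trans tr _; rewrite ler_nat.
have S := sum_expR_wt_ge w_gt0 t0 tH.
pose a (u : {ffun 'I_K -> 'I_H.+1}) := expR (- (t * (wt w u)%:R)) : R.
pose hi (u : {ffun 'I_K -> 'I_H.+1}) := (n < wt w u + Cs)%N.
pose lo (u : {ffun 'I_K -> 'I_H.+1}) := ((wt w u)%:R < (1 - 2 * eps) * n%:R).
pose mid (u : {ffun 'I_K -> 'I_H.+1}) := ((1 - 2 * eps) * n%:R <= (wt w u)%:R) && (wt w u + Cs <= n)%N.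
have t1 : 0 < (1 - eta) * t by rewrite mulr_gt0 // subr_gt0; lra.
have t2 : 0 < (1 + eta) * t by rewrite mulr_gt0 //; lra.
(* Chernoff bound: part of the exponential weight is paid at the edge of the window, and the
   remaining sum is a partition function at a shifted [t], controlled by [partfun_shift]. *)
have Shi : \sum_(u | hi u) a u <= partfun w K t / 8.
  apply: (@le_trans _ _ (\sum_(u : {ffun 'I_K -> 'I_H.+1})
      expR (- (eta * (t * (n%:R - Cs%:R)))) * expR (- ((1 - eta) * t * (wt w u)%:R)))).
    rewrite big_mkcond /=; apply: ler_sum => u _; case: ifP => [|_]; last by rewrite mulr_ge0 ?expR_ge0.
    rewrite /hi => /ltnW; rewrite -(ler_nat R) natrD => hu; rewrite -expRD ler_expR.
    have := mulr_ge0 (ltW (mulr_gt0 eta0 t0)) (_ : 0 <= (wt w u)%:R + Cs%:R - n%:R).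
    by rewrite subr_ge0 => /(_ hu); lra.
  rewrite -mulr_sumr; apply: le_trans (ler_wpM2l (expR_ge0 _) (sum_expR_wt_le w_gt0 K H t1)) _.
  apply: le_trans (ler_wpM2l (expR_ge0 _) (partfun_shift w_gt0 K t0 t1)) _.
  rewrite mulrCA ler_pM2l // -expRD; apply: le_trans e8; rewrite ler_expR.
  have -> : (t - (1 - eta) * t) * meanwt w K ((1 - eta) * t) = eta * X1 by rewrite /X1; ring.
  have -> : eta * (t * (n%:R - Cs%:R)) = eta * (nu - t * Cs%:R) by rewrite mulrBr tn.
  have h1 : eta * X1 <= eta * (nu * (1 - eps) + eps / 2 * nu).
    by rewrite ler_pM2l //; apply: le_trans X1u _; rewrite lerD2l.
  have h2 : eta * t * Cs%:R <= eta * tau_max * Cs%:R.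
    by rewrite ler_wpM2r ?ler0n // ler_pM2l.
  lra.
have Slo : \sum_(u | lo u) a u <= partfun w K t / 8.
  apply: (@le_trans _ _ (\sum_(u : {ffun 'I_K -> 'I_H.+1})
      expR (eta * (t * ((1 - 2 * eps) * n%:R))) * expR (- ((1 + eta) * t * (wt w u)%:R)))).
    rewrite big_mkcond /=; apply: ler_sum => u _; case: ifP => [|_]; last by rewrite mulr_ge0 ?expR_ge0.
    rewrite /lo => /ltW hu; rewrite -expRD ler_expR.
    have := mulr_ge0 (ltW (mulr_gt0 eta0 t0)) (_ : 0 <= (1 - 2 * eps) * n%:R - (wt w u)%:R).
    by rewrite subr_ge0 => /(_ hu); lra.
  rewrite -mulr_sumr; apply: le_trans (ler_wpM2l (expR_ge0 _) (sum_expR_wt_le w_gt0 K H t2)) _.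
  apply: le_trans (ler_wpM2l (expR_ge0 _) (partfun_shift w_gt0 K t0 t2)) _.
  rewrite mulrCA ler_pM2l // -expRD; apply: le_trans e8; rewrite ler_expR.
  have -> : (t - (1 + eta) * t) * meanwt w K ((1 + eta) * t) = - (eta * X2) by rewrite /X2; ring.
  have -> : eta * (t * ((1 - 2 * eps) * n%:R)) = eta * ((1 - 2 * eps) * nu).
    by rewrite [t * _]mulrCA tn.
  have h1 : eta * (nu * (1 - eps) - eps / 2 * nu) <= eta * X2.
    by rewrite ler_pM2l //; apply: le_trans X2l; rewrite lerD2l lerN2.
  have h2 : 0 <= eta * tau_max * Cs%:R by rewrite !mulr_ge0 ?ler0n // ltW.
  lra.
have Smid := sum_expR_mid_le ((1 - 2 * eps) * n%:R) Kn nH t0.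
have : \sum_u a u <= \sum_(u | hi u) a u + \sum_(u | lo u) a u + \sum_(u | mid u) a u.
  rewrite [X in X + _ + _]big_mkcond [X in _ + X + _]big_mkcond [X in _ + X]big_mkcond -!big_split /=.
  apply: ler_sum => u _; rewrite /hi /lo /mid.
  have := expR_gt0 (- (t * (wt w u)%:R)); rewrite -/(a u) => a0.
  rewrite ltNge ltnNge; move: (a u) a0 => z z0.
  case: ((1 - 2 * eps) * n%:R <= (wt w u)%:R); case: (wt w u + Cs <= n)%N => /=; lra.
move: S Smid; rewrite -/(\sum_u a u) -/(\sum_(u | mid u) a u).
rewrite [t * _]mulrCA tn; set Sm := \sum_(u | mid u) a u.
set S1 := \sum_u a u; set S2 := \sum_(u | hi u) a u in Shi *; set S3 := \sum_(u | lo u) a u in Slo *.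
set X := (1 - 2 * eps) * nu => S Smid SS.
have {}Smid : partfun w K t / 4 <= expR (- X) * (n%:R * #|ofwt K H n|%:R).
  apply: le_trans Smid; lra.
move: Smid; rewrite expRN ler_pdivlMl ?expR_gt0 // => Smid.
rewrite -mulrA; lra.
Qed.

End CardOfwtLower.

(** * Placing the gadgets *)

(** The offset [b] is the residue modulo [N]. After division by [N], the dilates by [j + 1] of the
    interval $(Z_0, Z_0 + r]$ are disjoint for different [j], since $Nr + r \le Z_0$. *)
Lemma dilation_inj (N Z0 r j b z j' b' z' : nat) :
  (0 < N)%N -> (r * N.+1 <= Z0)%N -> (j < N)%N -> (b < N)%N -> (z < r)%N ->
  (j' < N)%N -> (b' < N)%N -> (z' < r)%N ->
  (j.+1 * N * (Z0 + z.+1) + b = j'.+1 * N * (Z0 + z'.+1) + b')%N ->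
  [/\ z = z', j = j' & b = b'].
Proof.
move=> N0 rZ jN bN zr j'N b'N z'r E.
have bb : b = b'.
  have := congr1 (fun x => x %% N)%N E.
  by rewrite !(mulnAC _ N) !modnMDl !modn_small.
move: E; rewrite bb => /addIn /eqP.
rewrite !(mulnAC _ N) eqn_pmul2r // => /eqP E.
have sep x y s t : (x < y)%N -> (y < N)%N -> (s < r)%N ->
    (x.+1 * (Z0 + s.+1) = y.+1 * (Z0 + t.+1))%N -> False.
  move=> xy yN sr E'.
  have h1 : (x.+2 * (Z0 + t.+1) <= y.+1 * (Z0 + t.+1))%N by rewrite leq_mul2r; lia.
  have h2 : (x.+1 * (Z0 + s.+1) <= x.+1 * (Z0 + r))%N by rewrite leq_mul2l; lia.
  have h3 : (x.+1 * r <= N * r)%N by rewrite leq_mul2r; lia.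
  have h4 : (x.+1 * (Z0 + r) = x.+1 * Z0 + x.+1 * r)%N by rewrite mulnDr.
  have h5 : (x.+2 * (Z0 + t.+1) = x.+1 * Z0 + Z0 + x.+2 * t.+1)%N by rewrite mulnDr mulSn; lia.
  have h6 : (r * N.+1 = N * r + r)%N by rewrite mulnS mulnC addnC.
  lia.
case: (ltngtP j j') => [jj|jj|jj].
- by case: (sep _ _ _ _ jj j'N zr E).
- by case: (sep _ _ _ _ jj jN z'r (esym E)).
split=> //; move: E; rewrite jj => /eqP; rewrite eqn_pmul2l // eqn_add2l => /eqP; lia.
Qed.

Section Gadget.
Variables (f : {poly rat}) (hf : admissible f) (c : nat -> int).
Local Notation N := (size f).
Local Notation J := ('I_N * 'I_N)%type.
(* In [\sum_b c b * f(b) = 0] each [f(b)] is replaced, by the vanishing of the N-th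
   difference along the step [y], by a combination of the values [f(b + (j+1) y)].
   The positive and negative parts of the result are the two states of a gadget,
   which have the same weight and differ by [Pi_f] parts. *)
Definition gadget (x : J) : int := - dcoef N x.1.+1 * c x.2.
Definition gpos (x : J) : nat := if 0 <= gadget x then `|gadget x|%N else 0%N.
Definition gneg (x : J) : nat := if 0 <= gadget x then 0%N else `|gadget x|%N.

Lemma gadgetE x : gadget x = (gpos x)%:Z - (gneg x)%:Z.
Proof. by rewrite /gpos /gneg; case: (leP 0 (gadget x)) => ?; lia. Qed.

Hypothesis c1 : \sum_(b < N) c b = (Pi_f f)%:Z.
Hypothesis c2 : \sum_(b < N) c b * intval f b%:Z = 0.

(** The coefficients of the [N]-th difference with $j \ge 1$ sum to $-1$, so moving the relation to
    remote indices preserves its total. *)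
Lemma sum_gadget : \sum_x gadget x = (Pi_f f)%:Z.
Proof.
rewrite -(pair_bigA _ (fun j b => gadget (j, b))) exchange_big /= -c1.
apply: eq_bigr => b _; rewrite /gadget /= -mulr_suml -[RHS]mul1r; congr (_ * _).
rewrite sumrN; have := sum_dcoef (pdeg f); rewrite -size_admissible // big_ord_recl dcoef0.
under eq_bigr => i _ do rewrite lift0.
by move=> /eqP; rewrite addr_eq0 => /eqP <-.
Qed.

Lemma sum_gadget_intval (y : nat) :
  \sum_(x : J) gadget x * intval f (x.1.+1 * y + x.2)%N%:Z = 0.
Proof.
rewrite -(pair_bigA _ (fun j b : 'I_N => gadget (j, b) * intval f (j.+1 * y + b)%N%:Z)).
rewrite exchange_big /= -[RHS]c2.
apply: eq_bigr => b _; rewrite (intval_difference_top hf b%:Z y%:Z) mulrN mulr_sumr -sumrN.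
apply: eq_bigr => j _; rewrite /gadget /= PoszD PoszM addrC.
by rewrite mulNr mulNr [c b * _]mulrCA mulrA [dcoef _ _ * c b]mulrC -mulrA.
Qed.

Lemma sum_gpos : (\sum_x gpos x = \sum_x gneg x + Pi_f f)%N.
Proof.
apply/eqP; rewrite -eqz_nat PoszD -sum_gadget !(big_morph Posz PoszD (erefl _)) -big_split /=.
by apply/eqP; apply: eq_bigr => x _; rewrite gadgetE addrC subrK.
Qed.

Lemma sum_gpos_wf (y : nat) : (0 < y)%N ->
  (\sum_(x : J) gpos x * wf f (x.1.+1 * y + x.2).-1 =
   \sum_(x : J) gneg x * wf f (x.1.+1 * y + x.2).-1)%N.
Proof.
move=> y0; apply/eqP; rewrite -eqz_nat !(big_morph Posz PoszD (erefl _)) -subr_eq0 -sumrB.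
apply/eqP; rewrite -[RHS](sum_gadget_intval y); apply: eq_bigr => x _.
rewrite !PoszM -mulrBl -gadgetE wfE // prednK //.
by rewrite addn_gt0 muln_gt0 y0.
Qed.

End Gadget.

(** * Counting the partitions of [n] with few gadget instances *)

Section FewInstances.
Variables (R : realType) (w : nat -> nat).
Hypothesis w_gt0 : forall i, (0 < w i)%N.
Variables (K H r : nat) (J : finType) (pos : 'I_r -> J -> 'I_K) (al : J -> 'I_H.+1).
Hypothesis pos_inj : forall i c i' c', pos i c = pos i' c' -> i = i' /\ c = c'.
Variables (t q1 q2 : R) (G : nat).
Hypothesis t0 : 0 < t.
Hypothesis q10 : 0 < q1.
Hypothesis q11 : q1 <= 1.
Hypothesis q20 : 0 < q2.
Hypothesis alG : forall x, (al x <= G)%N.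

Let y (x : 'I_K) : R := expR (- (t * (w x)%:R)).
Hypothesis yq1 : forall i x, q1 <= y (pos i x).
Hypothesis yq2 : forall i x, q2 <= 1 - y (pos i x).

Let y0 x : 0 < y x. Proof. exact: expR_gt0. Qed.
Let y1 x : y x < 1. Proof. by rewrite expR_lt1 oppr_lt0 mulr_gt0 // ltr0n. Qed.

(** At each position the probability is at least $y^{al}(1 - y)$, because the truncated geometric
    sum is at most $1/(1-y)$. *)
Lemma inst_prob_ge i : (q1 ^+ G * q2) ^+ #|J| <= inst_prob pos al y i.
Proof.
rewrite -prodr_const; apply: ler_prod => x _.
have q0 : 0 <= q1 ^+ G * q2 by rewrite mulr_ge0 ?exprn_ge0 // ltW.
rewrite q0 /=; apply: ler_pM; rewrite ?exprn_ge0 ?(ltW q10) ?(ltW q20) //.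
  apply: (@le_trans _ _ (q1 ^+ al x)); first by rewrite ler_wiXn2l ?(ltW q10).
  by rewrite lerXn2r ?nnegrE ?(ltW q10) // ltW.
apply: le_trans (yq2 i x) _; rewrite -[leLHS]invrK lef_pV2 ?posrE ?invr_gt0 ?subr_gt0 //.
  by apply: geom_sum_le => //; exact: ltW.
by rewrite big_ord_recl expr0 ltr_pwDl // sumr_ge0 // => h _; rewrite exprn_ge0 // ltW.
Qed.

Lemma inst_prob_le1 i : inst_prob pos al y i <= 1.
Proof.
rewrite /inst_prob; apply: prodr_ile1 => x _.
have s0 : 0 < \sum_(h < H.+1) y (pos i x) ^+ h.
  by rewrite big_ord_recl expr0 ltr_pwDl // sumr_ge0 // => h _; rewrite exprn_ge0 // ltW.
apply/andP; split; first by rewrite divr_ge0 ?exprn_ge0 // ltW.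
rewrite ler_pdivrMr // mul1r (bigD1 (al x)) //= lerDl sumr_ge0 // => h _.
by rewrite exprn_ge0 // ltW.
Qed.

(** All partitions of [n] have the same Gibbs weight $e^{-tn}$, which converts the measure of [A]
    into its cardinality. *)
Lemma few_instances_count (n R0 : nat) (A : {set {ffun 'I_K -> 'I_H.+1}}) :
  (forall u, u \in A -> wt w u = n) ->
  (forall u, u \in A -> (#|[set i | inst pos al i u]| <= R0)%N) ->
  #|A|%:R <= expR (t * n%:R) * (2 ^+ R0 * partfun w K t * (1 - (q1 ^+ G * q2) ^+ #|J| / 2) ^+ r).
Proof.
move=> An AR; have B := few_instances_bound pos_inj y0 AR.
rewrite mulrC -ler_pdivrMr ?expR_gt0 // -expRN.
have -> : #|A|%:R * expR (- (t * n%:R)) = \sum_(u in A) \prod_x y x ^+ u x.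
  rewrite mulr_natl -sumr_const; apply: eq_bigr => u /An <-.
  by rewrite prod_expR_wt.
apply: le_trans B _; rewrite -!mulrA ler_pM2l ?exprn_gt0 //.
have fac i : 0 <= 1 - inst_prob pos al y i / 2 by have := inst_prob_le1 i; lra.
apply: ler_pM.
- by apply: prodr_ge0 => x _; apply: sumr_ge0 => h _; rewrite exprn_ge0 // ltW.
- by apply: prodr_ge0 => i _.
- by rewrite -sum_expR_wt sum_expR_wt_le.
- rewrite -[X in _ ^+ X](card_ord r) -prodr_const; apply: ler_prod => i _.
  by rewrite fac /= lerD2l lerN2 ler_pM2r ?invr_gt0 // inst_prob_ge.
Qed.

End FewInstances.

(** * The equidistribution bound with constants depending only on $f$ *)

Section NpartModEquidistribution.
Variables (R : realType) (f : {poly rat}) (hf : admissible f).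
Local Notation N := (size f).
Local Notation d := (pdeg f).
Local Notation J := ('I_N * 'I_N)%type.
Local Notation w := (wf f).

Lemma wf_growth : exists c0 C0 : R, [/\ 0 < c0, 0 < C0 &
  forall i : nat, c0 * i.+1%:R ^+ d <= (w i)%:R <= C0 * i.+1%:R ^+ d].
Proof.
have [c0 [C0 [c00 C00 cC]]] := intval_growth hf.
exists (ratr c0), (ratr C0); split; rewrite ?ltr0q // => i.
have -> : (w i)%:R = ratr (intval f i.+1%:Z)%:~R :> R by rewrite ratr_int -wfE -?pmulrn.
have -> : i.+1%:R = ratr i.+1%:R :> R by rewrite ratr_nat.
by rewrite -rmorphXn -!rmorphM /= !ler_rat cC.
Qed.

Section Geometry.
Variables (c0 C0 : R).
Hypothesis c00 : 0 < c0.
Hypothesis C00 : 0 < C0.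
Hypothesis growth : forall i, c0 * i.+1%:R ^+ d <= (w i)%:R <= C0 * i.+1%:R ^+ d.
Variable c : nat -> int.
Hypothesis c2 : \sum_(b < N) c b * intval f b%:Z = 0.

Definition gadC : R := C0 * (3 * N%:R ^+ 2) ^+ d.

Lemma gadget_positions (L : R) (n K : nat) : 1 <= L -> 4 * N.+1%:R <= L -> gadC <= L ->
  n%:R = L ^+ d.+1 -> (forall i, (K <= i)%N -> (n < w i)%N) ->
  exists (r : nat) (pos : 'I_r -> J -> 'I_K),
  [/\ (4 * N.+1%:R)^-1 * L <= r%:R,
      forall i x i' x', pos i x = pos i' x' -> i = i' /\ x = x',
      forall i, (\sum_x gpos c x * w (pos i x) = \sum_x gneg c x * w (pos i x))%N
    & forall i x, c0 * L ^+ d <= (w (pos i x))%:R <= gadC * L ^+ d].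
Proof.
move=> L1 LN LC nL Kn.
have L0 : 0 < L := lt_le_trans ltr01 L1.
have N0 : (0 < N)%N by rewrite size_admissible.
have /andP[m1 m2] := truncn_itv (ltW L0).
set Z0 := Num.truncn L in m1 m2.
pose r := (Z0 %/ N.+1)%N.
have rZ : (r * N.+1 <= Z0)%N by exact: leq_trunc_div.
(* Gadget [i] uses the step $N(Z_0 + i + 1)$: the factor [N] is what [dilation_inj] asks for, and
   the size of order $L$ gives parts of order $L^d$. These are at most $n = L \cdot L^d$ once
   [gadC <= L]. The predecessors below reflect the shift of indices in [wf]. *)
pose idx (i : nat) (x : J) := (x.1.+1 * (N * (Z0 + i.+1)) + x.2)%N.
have idx0 i x : (0 < idx i x)%N by rewrite addn_gt0 !muln_gt0 N0 addnS.
have Z00 : (0 < Z0)%N by rewrite lt0n; apply/eqP => Z; move: m2; rewrite Z; lra.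
have idxu i x : (i < r)%N -> (idx i x)%:R <= 3 * N%:R ^+ 2 * L.
  move=> ir; apply: (@le_trans _ _ (3 * N ^ 2 * Z0)%N%:R); last first.
    have -> : 3 * N%:R ^+ 2 = (3 * N ^ 2)%N%:R :> R by rewrite natrM natrX.
    by rewrite natrM ler_wpM2l // ler0n.
  rewrite ler_nat /idx.
  have h1 : (x.1.+1 * (N * (Z0 + i.+1)) <= N * (N * (Z0 + Z0)))%N.
    apply: leq_mul; first exact: ltn_ord.
    rewrite leq_mul2l leq_add2l (leq_trans ir) ?orbT //; nia.
  have h2 : (x.2 <= N * N * Z0)%N.
    apply: leq_trans (ltnW (ltn_ord _)) _; nia.
  apply: leq_trans (leq_add h1 h2) _; rewrite -mulnn; lia.
have idxl i x : L <= (idx i x)%:R.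
  apply: le_trans (ltW m2) _; rewrite ler_nat /idx.
  apply: leq_trans (leq_addr _ _); apply: (@leq_trans (Z0 + i.+1)); first lia.
  by rewrite mulnA leq_pmull // muln_gt0 N0.
have wb i x : (i < r)%N -> c0 * L ^+ d <= (w (idx i x).-1)%:R <= gadC * L ^+ d.
  move=> ir; have /andP[g1 g2] := growth (idx i x).-1.
  rewrite prednK // in g1 g2; apply/andP; split.
    apply: le_trans g1; rewrite ler_pM2l // lerXn2r ?nnegrE ?ler0n ?(ltW L0) //.
  apply: le_trans g2 _; rewrite /gadC -mulrA -exprMn ler_pM2l //.
  by rewrite lerXn2r ?nnegrE ?ler0n ?mulr_ge0 ?exprn_ge0 ?ler0n ?(ltW L0) // idxu.
have idxK i x : (i < r)%N -> ((idx i x).-1 < K)%N.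
  move=> ir; rewrite ltnNge; apply/negP => /Kn; rewrite ltnNge => /negP; apply.
  rewrite -(ler_nat R) nL exprS; have /andP[_ g2] := wb i x ir.
  by apply: le_trans g2 _; rewrite ler_wpM2r // exprn_ge0 // ltW.
exists r, (fun (i : 'I_r) (x : J) => Ordinal (idxK i x (ltn_ord i))); split.
- have : (Z0 < (r + 1) * N.+1)%N by rewrite addn1 ltn_ceil.
  rewrite -(ltr_nat R) natrM natrD => h.
  have N1 : 0 < (N.+1%:R : R) by rewrite ltr0n.
  rewrite mulrC ler_pdivrMr; last by rewrite mulr_gt0.
  have M1 : 1 <= (N.+1%:R : R) by rewrite ler1n.
  move: m2 h; rewrite -[Z0.+1%:R]natr1 mulrDl mul1r [r%:R * (4 * _)]mulrCA; lra.
- move=> i x i' x' /(congr1 val) /= E.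
  have {}E : idx i x = idx i' x' by rewrite -(prednK (idx0 i x)) -(prednK (idx0 i' x')) E.
  move: E; rewrite /idx !mulnA => E.
  have [ii jj bb] := dilation_inj N0 rZ (ltn_ord x.1) (ltn_ord x.2) (ltn_ord i)
    (ltn_ord x'.1) (ltn_ord x'.2) (ltn_ord i') E.
  split; first exact: val_inj.
  by case: x x' jj bb {E} => [j b] [j' b'] /= /val_inj -> /val_inj ->.
- move=> i; have y0 : (0 < N * (Z0 + i.+1))%N by rewrite muln_gt0 N0 addnS.
  exact: (sum_gpos_wf hf c2 y0).
- by move=> i x; exact: wb.
Qed.

End Geometry.

Lemma coprime_delta_quotient (k delta : nat) : (0 < k)%N -> (delta %| Pi_f f)%N ->
  (forall p, prime p -> (p %| k)%N -> ~~ (p * delta %| Pi_f f)%N) ->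
  coprime k (Pi_f f %/ delta).
Proof.
move=> k0 dP hp; rewrite /coprime; apply/negPn/negP => g1.
have g0 : (0 < gcdn k (Pi_f f %/ delta))%N by rewrite gcdn_gt0 k0.
have {}g1 : (1 < gcdn k (Pi_f f %/ delta))%N by rewrite ltn_neqAle eq_sym g1.
have pg := pdiv_dvd (gcdn k (Pi_f f %/ delta)).
have /negP := hp _ (pdiv_prime g1) (dvdn_trans pg (dvdn_gcdl _ _)); apply.
by rewrite -[X in (_ %| X)%N](divnK dP) dvdn_mul // (dvdn_trans pg) // dvdn_gcdr.
Qed.

(** Modulo [delta] every part is congruent to $f(0)$, so [n] is congruent to $f(0)$ times the number
    of parts, and $f(0)$ is a unit. Thus the class modulo [delta] consists of all partitions of
    [n]. *)
Lemma cnt_congruent (K H n delta : nat) (a : int) (u : {ffun 'I_K -> 'I_H.+1}) :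
  (delta %| Pi_f f)%N -> (n%:Z = a * intval f 0 %[mod delta])%Z -> wt w u = n ->
  (delta %| (cnt u)%:Z - a)%Z.
Proof.
move=> dP na wu.
have cop := coprime_intval0 hf dP.
rewrite -(@Gauss_dvdzl _ _ (intval f 0)) // mulrBl.
have -> : (cnt u)%:Z * intval f 0 = n%:Z - \sum_x (u x)%:Z * ((w x)%:Z - intval f 0).
  rewrite -wu /wt /cnt !(big_morph Posz PoszD (erefl _)) mulr_suml -sumrB.
  by apply: eq_bigr => x _; rewrite PoszM mulrBr opprB addrC subrK.
rewrite addrAC rpredB //; first by rewrite -eqz_mod_dvd; apply/eqP.
apply: rpred_sum => x _; apply: dvdz_mull; rewrite wfE //.
by apply: dvdz_trans (Pi_f_dvd _ _); rewrite dvdzE.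
Qed.

Lemma npart_mod_equidistribution : exists2 kap : R, 0 < kap & exists2 L0 : R, 1 <= L0 &
  forall (L : R) (n k delta : nat) (a : int), L0 <= L -> n%:R = L ^+ d.+1 ->
  (0 < k)%N -> (delta %| Pi_f f)%N ->
  (forall p, prime p -> (p %| k)%N -> ~~ (p * delta %| Pi_f f)%N) ->
  (n%:Z = a * intval f 0 %[mod delta])%Z ->
  0 < (npart_mod f a delta n)%:R :> R /\
  `|(npart_mod f a (delta * k) n)%:R - (npart_mod f a delta n)%:R / k%:R| <=
  (npart_mod f a delta n)%:R *
    (expR (- (kap * L / k%:R ^+ 2)) + 4 * n%:R * expR (- (16 * (kap * L)))) :> R.
Proof.
have [c0 [C0 [c00 C00 growth]]] := wf_growth.
have [c [c1 c2]] := intval_gadget hf.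
have [Cs semi] := intval_semigroup hf.
have d0 := pdeg_gt0 hf.
have w0 := wf_gt0 hf.
pose t1 := tau_min C0; pose t2 := tau_max c0.
have t10 : 0 < t1 := tau_min_gt0 C00.
have t20 : 0 < t2 := lt_le_trans t10 (tau_min_le_max c0 C0).
have gC0 : 0 < gadC C0.
  by rewrite mulr_gt0 // exprn_gt0 // mulr_gt0 // exprn_gt0 // ltr0n size_admissible.
pose G := (\sum_(x : J) gpos c x)%N.
pose q1 := expR (- (t2 * gadC C0)); pose q2 := 1 - expR (- (t1 * c0)).
have q10 : 0 < q1 by exact: expR_gt0.
have q11 : q1 <= 1 by rewrite -[leRHS]expR0 ler_expR oppr_le0 mulr_ge0 // ltW.
have q20 : 0 < q2 by apply: sub1_expRN_gt0; rewrite mulr_gt0.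
have q0 : 0 < q1 ^+ G * q2 by rewrite mulr_gt0 // exprn_gt0.
have [p0 [p0E p00 p01]] : exists p0 : R, [/\ p0 = (q1 ^+ G * q2) ^+ #|{: J}|, 0 < p0 & p0 <= 1].
  exists ((q1 ^+ G * q2) ^+ #|{: J}|); split=> //; first exact: exprn_gt0.
  rewrite exprn_ile1 ?(ltW q0) // mulr_ile1 ?exprn_ge0 ?exprn_ile1 ?(ltW q10) ?(ltW q20) //.
  by rewrite /q2 gerBl expR_ge0.
have [c3 [c3E c30]] : exists c3 : R, c3 = (4 * N.+1%:R)^-1 /\ 0 < c3.
  by exists (4 * N.+1%:R)^-1; rewrite invr_gt0 mulr_gt0 // ltr0n.
(* The Gibbs loss $2\epsilon\tau L$ must stay below the gain $3 p_0 r/8$ from rarity of instances.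
   With $r \ge c_3 L$ the remaining exponent is $-p_0 c_3 L/4$, that is, $-16$ [kap] $L$. *)
have [eps [eps0 eps1 eps2]] : exists eps : R, [/\ 0 < eps, eps <= 4^-1 & 2 * eps * t2 <= p0 * c3 / 8].
  exists (Num.min 4^-1 (p0 * c3 / (16 * t2))); split.
  - by rewrite lt_min invr_gt0 ltr0n /= divr_gt0 ?mulr_gt0.
  - by rewrite ge_min lexx.
  have : Num.min 4^-1 (p0 * c3 / (16 * t2)) <= p0 * c3 / (16 * t2) by rewrite ge_min lexx orbT.
  rewrite ler_pdivlMr ?mulr_gt0 //; lra.
have semi' h : (Cs.+1 <= h)%N -> exists e : nat -> nat, (\sum_(i < N) e i * w i = h)%N.
  by move=> /ltnW /semi.
have [L1 L11 low] := card_ofwt_lower w0 semi' (ltn0Sn Cs) d0 c00 C00 growth eps0 eps1.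
(* More than [R0] active gadgets means at least $p_0 c_3 L/8$ of them; [equidistribution] divides
   this by $8k^2$, hence 64. *)
have [kap [kapE kap0]] : exists kap : R, kap = p0 * c3 / 64 /\ 0 < kap.
  by exists (p0 * c3 / 64); rewrite divr_gt0 ?mulr_gt0.
exists kap => //.
exists (Num.max L1 (Num.max (4 * N.+1%:R) (gadC C0))); first by rewrite le_max L11.
move=> L n k delta a; rewrite !ge_max => /andP[LL1 /andP[LN LG]] nL k0 dP hp na.
have Lge1 : 1 <= L := le_trans L11 LL1.
have Lp : 0 < L := lt_le_trans ltr01 Lge1.
have Ld : 0 < L ^+ d by rewrite exprn_gt0.
pose K := (Num.truncn (n%:R / c0 : R)).+1.
have Kn i : (K <= i)%N -> (n < w i)%N.
  move=> Ki; have nc : 0 <= n%:R / c0 :> R by rewrite divr_ge0 ?ler0n // ltW.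
  have /andP[_ tr] := truncn_itv nc.
  have : n%:R < c0 * i.+1%:R ^+ d :> R.
    rewrite mulrC -ltr_pdivrMr //; apply: lt_le_trans tr _.
    apply: (@le_trans _ _ i.+1%:R); first by rewrite ler_nat; apply: leq_trans Ki _.
    by rewrite -[leLHS]expr1 ler_weXn2l // ler1n.
  by rewrite -(ltr_nat R) => /lt_le_trans; apply; case/andP: (growth i).
have [tau tauI [H1 HL]] := low L n K LL1 nL Kn.
have [r [pos [rL pinj pwt pbd]]] := gadget_positions c00 C00 growth c2 Lge1 LN LG nL Kn.
rewrite -c3E in rL.
have [H [HH nH GH]] : exists H, [/\ (H1 <= H)%N, (n <= H)%N & (G <= H)%N].
  by exists (maxn H1 (maxn n G)); rewrite !leq_max !leqnn ?orbT.
have {}HL := HL H HH.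
have sg := sum_gpos hf c1.
pose al (x : J) : 'I_H.+1 := inord (gpos c x).
pose be (x : J) : 'I_H.+1 := inord (gneg c x).
have gpG (x : J) : (gpos c x <= G)%N.
  by rewrite /G; rewrite (bigD1 (P := xpredT) (F := gpos c) x) //= leq_addr.
have alE (x : J) : al x = gpos c x :> nat by rewrite inordK // ltnS; apply: leq_trans GH.
have beE (x : J) : be x = gneg c x :> nat.
  rewrite inordK // ltnS; apply: leq_trans GH; rewrite /G sg (bigD1 x) //= -addnA; exact: leq_addr.
have albe i : (\sum_x al x * w (pos i x) = \sum_x be x * w (pos i x))%N.
  under eq_bigr => x _ do rewrite alE; under [RHS]eq_bigr => x _ do rewrite beE.
  exact: pwt.
have albeP : (\sum_x al x = \sum_x be x + Pi_f f)%N.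
  under eq_bigr => x _ do rewrite alE; under [in RHS]eq_bigr => x _ do rewrite beE.
  exact: sg.
have P0 := Pi_f_gt0 hf.
set A := ofwt w K H n in HL.
have np0 : npart_mod f a delta n = #|A|.
  rewrite (npart_mod_ffun hf _ _ Kn nH); apply: eq_card => u; rewrite !inE.
  apply: andb_idr => /eqP wu; rewrite eqz_mod_dvd; exact: cnt_congruent na wu.
have /andP[taul taur] := tauI.
have tau0 : 0 < tau := lt_le_trans t10 taul.
set t := tau / L ^+ d in HL.
have t0 : 0 < t by rewrite divr_gt0.
have tn : t * n%:R = tau * L by rewrite nL /t exprSr mulrA divfK // gt_eqF.
have Zt0 := partfun_gt0 w0 K t0.
have A0 : 0 < #|A|%:R :> R.
  rewrite ltr0n lt0n; apply/eqP => A0; move: HL; rewrite A0 mulr0.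
  by rewrite leNgt mulr_gt0 ?expR_gt0.
rewrite np0; split; first exact: A0.
have wq1 i x : q1 <= expR (- (t * (w (pos i x))%:R)).
  rewrite /q1 ler_expR lerN2 /t -mulrA; apply: ler_pM; rewrite ?(ltW tau0) //.
    by rewrite mulr_ge0 ?invr_ge0 ?ler0n // ltW.
  by rewrite mulrC ler_pdivrMr //; case/andP: (pbd i x).
have wq2 i x : q2 <= 1 - expR (- (t * (w (pos i x))%:R)).
  rewrite /q2 lerD2l lerN2 ler_expR lerN2 /t -mulrA; apply: ler_pM; rewrite ?(ltW t10) ?(ltW c00) //.
  by rewrite mulrC ler_pdivlMr //; case/andP: (pbd i x).
have alG x : (al x <= G)%N by rewrite alE.
(* The threshold lies well below the expected number of instances: $2^{R_0} \le e^{p_0 r/8}$,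
   against $(1 - p_0/2)^r \le e^{-p_0 r/2}$. *)
pose R0 := Num.truncn (p0 * r%:R / 8 : R).
have pr0 : 0 <= p0 * r%:R / 8 by rewrite divr_ge0 ?mulr_ge0 ?ler0n // ltW.
have /andP[R0l R0u] := truncn_itv pr0.
rewrite -/R0 in R0l R0u.
(* Only gadgets in state [al] are counted here. Those in state [be] are active as well, so this is a
   lower estimate of the number of nonzero drifts. *)
pose bad := [set u in A | (#|[set i | inst pos al i u]| <= R0)%N].
have badb : #|bad|%:R <= #|A|%:R * (4 * n%:R * expR (- (16 * (kap * L)))).
  have b1 u : u \in bad -> wt w u = n by rewrite !inE => /andP[/eqP].
  have b2 u : u \in bad -> (#|[set i | inst pos al i u]| <= R0)%N by rewrite inE => /andP[].
  apply: le_trans (few_instances_count w0 pinj t0 q10 q11 q20 alG wq1 wq2 b1 b2) _.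
  rewrite -p0E tn.
  have e1 : (1 - p0 / 2) ^+ r <= expR (- (p0 * r%:R / 2)).
    have -> : - (p0 * r%:R / 2) = r%:R * (- (p0 / 2)) by field.
    rewrite expRM_natl lerXn2r ?nnegrE ?expR_ge0 ?expR_ge1Dx //.
    by move: p01; lra.
  have e2 : 2 ^+ R0 <= expR (p0 * r%:R / 8).
    apply: (@le_trans _ _ (expR R0%:R)); last by rewrite ler_expR.
    rewrite -[R0%:R]mulr1 expRM_natl lerXn2r ?nnegrE ?expR_ge0 //.
    by have := expR_ge1Dx (1 : R).
  have z1 : partfun w K t <= expR (- ((1 - 2 * eps) * (tau * L))) * (4 * n%:R * #|A|%:R).
    by rewrite expRN ler_pdivlMl ?expR_gt0.
  have one0 : 0 <= 1 - p0 / 2.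
    by move: p01; lra.
  apply: (@le_trans _ _ (expR (tau * L) * (expR (p0 * r%:R / 8) *
     (expR (- ((1 - 2 * eps) * (tau * L))) * (4 * n%:R * #|A|%:R)) * expR (- (p0 * r%:R / 2))))).
    rewrite ler_pM2l ?expR_gt0 //; apply: ler_pM => //.
    - by rewrite mulr_ge0 ?exprn_ge0 // ltW.
    - by rewrite exprn_ge0.
    - by apply: ler_pM => //; rewrite ?exprn_ge0 // ltW.
  have -> : expR (tau * L) * (expR (p0 * r%:R / 8) *
     (expR (- ((1 - 2 * eps) * (tau * L))) * (4 * n%:R * #|A|%:R)) * expR (- (p0 * r%:R / 2))) =
     #|A|%:R * (4 * n%:R * expR (2 * eps * tau * L - p0 * r%:R * (3 / 8))).
    have -> : 2 * eps * tau * L - p0 * r%:R * (3 / 8) =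
      tau * L + (p0 * r%:R / 8 + (- ((1 - 2 * eps) * (tau * L)) + (- (p0 * r%:R / 2)))) by field.
    rewrite !expRD; ring.
  rewrite ler_pM2l //; apply: ler_wpM2l; first by rewrite mulr_ge0 ?ler0n.
  rewrite ler_expR kapE.
  have h1 : 2 * eps * tau * L <= p0 * c3 / 8 * L.
    rewrite ler_pM2r //; apply: le_trans eps2; rewrite ler_pM2l // mulr_gt0 //.
  have h2 : p0 * (c3 * L) <= p0 * r%:R by rewrite ler_pM2l.
  lra.
pose P' := (Pi_f f %/ delta)%N.
have PE : Pi_f f = (P' * delta)%N by rewrite divnK.
have delta0 : (0 < delta)%N := dvdn_gt0 P0 dP.
have cop := coprime_delta_quotient k0 dP hp.
rewrite -/P' in cop.
have [v vP] : exists v : int, (v * P'%:Z = 1 %[mod k])%Z.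
  have [v [v' vv]] := Bezoutz P'%:Z k%:Z.
  exists v; apply/eqP; rewrite eqz_mod_dvd.
  have g1 : gcdz P'%:Z k%:Z = 1 by rewrite /gcdz /= gcdnC (eqP cop).
  by rewrite -g1 -vv opprD addNKr rpredN dvdz_mull.
(* The inverse [v] of [Pi_f f / delta] modulo [k] normalizes the effect of a swap to a step of
   exactly $\pm 1$, as the contraction estimate requires. *)
pose b (u : {ffun 'I_K -> 'I_H.+1}) : int := v * (((cnt u)%:Z - a) %/ delta)%Z.
have bE u : u \in A -> (k %| b u)%Z = ((cnt u)%:Z == a %[mod (delta * k)%N])%Z.
  rewrite inE => /eqP wu; have := cnt_congruent dP na wu; rewrite eqz_mod_dvd /b => /dvdzP[q ->].
  rewrite mulzK ?eqz_nat -?lt0n // PoszM [q * _]mulrC dvdz_mul2l ?eqz_nat -?lt0n //.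
  rewrite Gauss_dvdzr //; apply/coprimezP.
  have /eqP := vP; rewrite eqz_mod_dvd => /dvdzP[q' q'E].
  by exists (- q', P'%:Z) => /=; rewrite mulNr -q'E opprB [P'%:Z * v]mulrC subrK.
have bs i u : (b (swap pos al be i u) = b u + drift pos al be i u %[mod k])%Z.
  rewrite /b (cnt_swap pinj albeP P0) PE PoszM addrAC.
  have -> : P'%:Z * delta%:Z * drift pos al be i u = P'%:Z * drift pos al be i u * delta%:Z.
    by rewrite mulrAC.
  rewrite (divzDr _ (dvdz_mull _ (dvdzz delta))).
  rewrite mulzK ?eqz_nat -?lt0n // mulrDr; apply/eqP; rewrite eqz_modDl mulrA.
  rewrite -modzMml vP modzMml mul1r.
  by [].
have As i u : (swap pos al be i u \in A) = (u \in A).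
  by rewrite !inE (wt_swap pinj albe).
have := @equidistribution R k r _ A (swap pos al be) (drift pos al be) b k0
  (swapK pinj albeP P0) As (drift_le1 pos al be) (fun i j u => @drift_swap _ _ _ _ _ pinj al be i j u) bs.
have -> : [set x in A | (k %| b x)%Z] =
  [set u : {ffun 'I_K -> 'I_H.+1} | (wt w u == n) && ((cnt u)%:Z == a %[mod (delta * k)%N])%Z].
  apply/setP => u; rewrite [LHS]inE [RHS]inE.
  have [uA|uA] := boolP (u \in A); first by rewrite bE //; move: uA; rewrite inE => ->.
  by move: uA; rewrite inE => /negbTE ->.
rewrite -(npart_mod_ffun hf _ _ Kn nH) => EQ.
apply: le_trans EQ _.
(* Bad partitions are charged the trivial bound 1, all others the exponential one. *)
apply: (@le_trans _ _ (\sum_(x in A) (expR (- (kap * L / k%:R ^+ 2)) + (x \in bad)%:R))).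
  apply: ler_sum => u uA; rewrite inE uA /=.
  case: leqP => [_|Ru]; last first.
    rewrite addr0 ler_expR lerN2.
    have kk : 0 < k%:R ^+ 2 :> R by rewrite exprn_gt0 // ltr0n.
    rewrite [(8 * _)^-1]invfM [X in _ <= X]mulrA ler_wpM2r ?invr_ge0 ?(ltW kk) // ler_pdivlMr //.
    have h1 : (R0.+1%:R : R) <= #|[set i | drift pos al be i u != 0]|%:R.
      rewrite ler_nat; apply: leq_trans Ru _; apply/subset_leq_card/fintype.subsetP => i.
      by rewrite !inE /drift => ->.
    apply: le_trans h1; apply: le_trans (ltW R0u).
    have h2 : p0 * (c3 * L) <= p0 * r%:R by rewrite ler_pM2l.
    rewrite kapE; lra.
  apply: (@le_trans _ _ 1); last by rewrite lerDr expR_ge0.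
  by rewrite -[leRHS]expR0 ler_expR oppr_le0 divr_ge0 ?mulr_ge0 ?exprn_ge0 ?ler0n.
rewrite big_split /= sumr_const -[_ *+ _]mulr_natl mulrDr lerD2l.
apply: le_trans badb; rewrite -natr_sum ler_nat -sum1_card [leqLHS]big_mkcond [leqRHS]big_mkcond /=.
by apply: leq_sum => u _; case: (u \in A) => //; case: (u \in bad).
Qed.

End NpartModEquidistribution.

(** * From the uniform bound to the relative error *)

Lemma error_absorb (R : realType) (kap L n k : R) : 0 < kap -> 1 <= k -> k <= L -> L <= n ->
  k * (expR (- (kap * L / k ^+ 2)) + 4 * n * expR (- (16 * (kap * L)))) <=
  (1 + 4 / kap) * (n * expR (- (kap * L / k ^+ 2))).
Proof.
move=> kap0 k1 kL Ln.
have k0 : 0 < k by exact: lt_le_trans k1.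
have L0 : 0 < L by exact: lt_le_trans kL.
have n0 : 0 < n by exact: lt_le_trans Ln.
have kapL : 0 < kap * L by rewrite mulr_gt0.
rewrite mulrDr [leRHS]mulrDl mul1r; apply: lerD.
  by rewrite ler_wpM2r ?expR_ge0 // (le_trans kL).
have dec : expR (- (kap * L)) <= expR (- (kap * L / k ^+ 2)).
  rewrite ler_expR lerN2 ler_pdivrMr ?exprn_gt0 // ler_peMr ?(ltW kapL) //.
  by rewrite exprn_ege1.
(* The rate 16 for the bad partitions is split as 15 + 1: the share 15 absorbs the factor [k <= L],
   and the share 1 already matches the rate $1/k^2$ since $k \ge 1$. *)
have lin : k * expR (- (15 * (kap * L))) <= kap^-1.
  rewrite expRN ler_pdivrMr ?expR_gt0 // mulrC ler_pdivlMr //.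
  have := expR_ge1Dx (15 * (kap * L)); have : k * kap <= L * kap by rewrite ler_pM2r.
  lra.
have -> : k * (4 * n * expR (- (16 * (kap * L)))) =
    4 * n * (k * expR (- (15 * (kap * L)))) * expR (- (kap * L)).
  have -> : - (16 * (kap * L)) = - (15 * (kap * L)) + - (kap * L) by ring.
  by rewrite expRD; ring.
have -> : 4 / kap * (n * expR (- (kap * L / k ^+ 2))) =
    4 * n * kap^-1 * expR (- (kap * L / k ^+ 2)) by ring.
rewrite ler_pM ?expR_ge0 ?mulr_ge0 ?expR_ge0 ?(ltW k0) ?(ltW n0) //.
by rewrite ler_pM2l // mulr_gt0.
Qed.

Lemma powR_invSK (R : realType) (x : R) (d : nat) : 0 <= x ->
  (x `^ (1 + d%:R)^-1) ^+ d.+1 = x.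
Proof.
move=> x0; have -> : 1 + d%:R = d.+1%:R :> R by rewrite -natr1 addrC.
by rewrite -powR_mulrn ?powR_ge0 // -powRrM mulVf ?pnatr_eq0 // powRr1.
Qed.

Local Open Scope classical_set_scope.
Local Open Scope ring_scope.

Theorem theorem1p1 (R : realType) (f : {poly rat}) (hf : admissible f) :
  exists delta_f : R, 0 < delta_f /\
  exists C : R, 0 < C /\
  forall delta : nat, (0 < delta)%N -> (delta %| Pi_f f)%N ->
  forall a k : nat -> nat,
    (forall n, (0 < a n)%N) ->
    (forall n, (0 < k n)%N) ->
    (forall n p, prime p -> (p %| k n)%N -> ~~ (p * delta %| Pi_f f)%N) ->
    (fun n => (k n)%:R : R^o) =o_\oo
      (fun n => n%:R `^ (2 + 2 * (pdeg f)%:R)^-1 / Num.sqrt (ln n%:R) : R^o) ->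
  \forall n \near \oo,
    (n%:Z = (a n)%:Z * intval f 0 %[mod delta])%Z ->
    exists E : R,
      `|E| <= C * (n%:R * expR (- (delta_f * (k n)%:R ^- 2
                                   * n%:R `^ (1 + (pdeg f)%:R)^-1))) /\
      (npart_mod f (a n) (delta * k n) n)%:R =
        (npart_mod f (a n) delta n)%:R / (k n)%:R * (1 + E).
Proof.
have [kap kap0 [L0 L01 main]] := npart_mod_equidistribution R hf.
exists kap; split=> //; exists (1 + 4 / kap); split; first by rewrite addr_gt0 ?divr_gt0.
move=> delta _ dvd a k _ kpos hk /eqoP /(_ 1 ltr01) ksmall.
near=> n => congr.
have ne : expR 1 <= n%:R :> R by near: n; exact: nbhs_infty_ger.
have nL0 : L0 ^+ (pdeg f).+1 <= n%:R by near: n; exact: nbhs_infty_ger.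
have n0 : 0 < n%:R :> R by apply: lt_le_trans ne; exact: expR_gt0.
have n1 : 1 <= n%:R :> R by rewrite ler1n -(ltr0n R).
have d1 : 1 <= 1 + (pdeg f)%:R :> R by rewrite lerDl.
set L := n%:R `^ (1 + (pdeg f)%:R)^-1.
have LE : n%:R = L ^+ (pdeg f).+1 by rewrite powR_invSK // ltW.
have LL0 : L0 <= L.
  by rewrite -(ler_pXn2r (ltn0Sn (pdeg f))) ?nnegrE ?powR_ge0 -?LE // (le_trans ler01).
have Ln : L <= n%:R.
  by rewrite -[leRHS]powRr1 ?(ltW n0) // /L ler_powR // invf_le1 // (lt_le_trans ltr01).
(* For large [n] the growth condition gives this, because the exponent $1/(2+2d)$ is at most
   $1/(1+d)$ and $\log n \ge 1$ from $n \ge e$ on. *)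
have kL : (k n)%:R <= L.
  have : `|(k n)%:R : R^o| <= 1 * `|n%:R `^ (2 + 2 * (pdeg f)%:R)^-1 / Num.sqrt (ln n%:R) : R^o|.
    by near: n.
  have ln1 : 1 <= ln (n%:R : R) by rewrite -[leLHS]expRK ler_ln ?posrE ?expR_gt0.
  have s1 : 1 <= Num.sqrt (ln (n%:R : R)) by rewrite -[leLHS]sqrtr1 ler_sqrt // (le_trans ler01).
  rewrite mul1r !ger0_norm ?ler0n ?divr_ge0 ?powR_ge0 ?sqrtr_ge0 // => /le_trans; apply.
  rewrite ler_pdivrMr ?(lt_le_trans ltr01) //.
  apply: (@le_trans _ _ L); last by rewrite ler_peMr ?powR_ge0.
  rewrite /L ler_powR // lef_pV2 ?posrE; lra.
have [p0 bound] := main L n (k n) delta (a n) LL0 LE (kpos n) dvd (hk n) congr.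
set p := (npart_mod f (a n) delta n)%:R in p0 bound *.
set q := (npart_mod f (a n) (delta * k n) n)%:R in bound *.
have k1 : 1 <= (k n)%:R :> R by rewrite ler1n.
have k0 : 0 < (k n)%:R :> R by exact: lt_le_trans k1.
(* [E] is the relative error itself, well defined because [main] also gives [0 < p]. *)
exists ((k n)%:R / p * (q - p / (k n)%:R)); split; last by field; rewrite !gt_eqF.
have -> : kap * (k n)%:R ^- 2 * L = kap * L / (k n)%:R ^+ 2 by ring.
apply: le_trans (error_absorb kap0 k1 kL Ln).
rewrite normrM ger0_norm ?divr_ge0 ?(ltW p0) ?(ltW k0) // -[_ / p * _]mulrA ler_pM2l //.
by rewrite mulrC ler_pdivrMr // [leRHS]mulrC.
Unshelve. all: by end_near. Qed.
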